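(* Consider the twisted orthotoric geometry determined by $\beta$ and $A_1,\dots,A_m$ (as in the context). The twisted orthotoric geometry is extremal if and only if one of the following holds: (1) $\varphi(\beta)=t\cdot(a,b)^{\otimes m}$ for some $t\in\mathbb R\setminus\{0\}$, i.e. $\langle\mu,\beta\rangle=t\prod_{j=1}^m(a+bx_j)$, and $$A_j(x_j)=(a+bx_j)^{m+1}\int\!\!\int\frac{\Upsilon(x_j)}{(a+bx_j)^{m+3}}dx_jdx_j,\quad j=1,\ldots,m,$$ where $\Upsilon$ is a $j$-independent polynomial such that $\deg\Upsilon\le m$. In particular, if $b=0$, then $A_j(x_j)=\tilde\Upsilon(x_j)+\nu_j^0+\nu_j^1x_j$, where $\nu_j^0,\nu_j^1\in\mathbb R$, $\tilde\Upsilon$ does not depend on $j$ and $\deg\tilde\Upsilon\le m+2$; and if $b\ne0$, then $A_j(x_j)=\bar\Upsilon(x_j)+(a+bx_j)^{m+1}(\nu_j^0+\nu_j^1x_j)$, where $\nu_j^0,\nu_j^1\in\mathbb R$, $\bar\Upsilon$ does not depend on $j$ and $\deg\bar\Upsilon\le m$. (2) $\varphi(\beta)$ does not decompose and exactly one of the following holds: (a) $m=2$ and, writing $\langle\mu,\beta\rangle=\kappa\,(a+b(x_1+x_2)+cx_1x_2)$ with $a,b,c\in\mathbb R$ and $\kappa$ a non-zero constant, for $j=1,2$ we have $$A_j(x_j)=\Upsilon(x_j)+\nu_j^0(b+cx_j)\big(ac-b^2+(b+cx_j)^2\big)+\nu_j^1\big((ac-b^2)^2-(b+cx_j)^4\big),$$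 where $\Upsilon$ is a $j$-independent polynomial of degree at most $4$ and $\nu_j^0,\nu_j^1\in\mathbb R$. (b) $m\ge3$ and $A_j=\Upsilon$, $j=1,\ldots,m$, where $\Upsilon$ is a $j$-independent polynomial such that $\deg\Upsilon\le m+2$.
   Context: Let $m\ge2$, $W=\mathbb R^2$, $\mathfrak h=S^mW^*$ (symmetric tensors) and $\varphi:\mathfrak h\hookrightarrow(W^* )^{\otimes m}$ the inclusion (Veronese factorization structure). With real variables $x_1,\dots,x_m$ and the pairing $\langle(u,v),(a,b)\rangle=ua+vb$, put $\langle\mu,\alpha\rangle=\langle(1,x_1)\otimes\cdots\otimes(1,x_m),\varphi(\alpha)\rangle$ for $\alpha\in\mathfrak h$; thus $\langle\mu,\alpha\rangle$ runs over all real linear combinations of the elementary symmetric polynomials $\sigma_0=1,\sigma_1,\dots,\sigma_m$ of $x_1,\dots,x_m$. ''$\varphi(\beta)$ decomposes'' means $\varphi(\beta)=t(a,b)^{\otimes m}$ for some $(a,b)\ne0$, $t\in\mathbb R\setminus\{0\}$. Put $\Delta_j=\prod_{s\ne j}(x_j-x_s)$, $\mu_\beta=\mu/\langle\mu,\beta\rangle$ and let $\psi(x)\in\mathfrak h$ be $(x,-1)^{\otimes m}$. Given $0\ne\beta\in\mathfrak h$ and smooth non-vanishing functions $A_j$ on open intervals $I_j$ such that $\Delta_j$ and $\langle\mu,\beta\rangle$ do not vanish on $\prod I_j$, the twisted orthotoric geometry is the (local) toric Kähler structure in coordinates $(x_1,\dots,x_m,t)$, $t\in\mathfrak t=\mathfrak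 h/\langle\beta\rangle$, $$g_\beta=\sum_{j}\Big(\tfrac{\Delta_j}{A_j(x_j)\langle\mu,\beta\rangle}dx_j^2+\tfrac{A_j(x_j)\langle\mu,\beta\rangle}{\Delta_j}\langle\partial_{x_j}\mu_\beta,dt\rangle^2\Big),\quad\omega_\beta=\sum_jdx_j\wedge\langle\partial_{x_j}\mu_\beta,dt\rangle,$$ $$J_\beta dx_j=\tfrac{A_j(x_j)\langle\mu,\beta\rangle}{\Delta_j}\langle\partial_{x_j}\mu_\beta,dt\rangle,\quad J_\beta dt=\sum_j\tfrac{\psi(x_j)\ \mathrm{mod}\ \beta}{A_j(x_j)}dx_j$$ ($A_j$ such that $g_\beta$ is positive definite). It is extremal if its scalar curvature is a Killing potential; for this geometry this amounts to the existence of $\alpha\in\mathfrak h$ with $$\sum_{j=1}^m\frac{\langle\mu,\beta\rangle^{m+3}}{\Delta_j}\partial_{x_j}^2\Big(\frac{A_j(x_j)}{\langle\mu,\beta\rangle^{m+1}}\Big)=\langle\mu,\alpha\rangle .$$ $\int\!\int F\,dx\,dx$ denotes some second antiderivative of $F$ (determined up to adding an affine function, whose choice may depend on $j$). ''$j$-independent'' means the same polynomial for all $j$.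
   Formalization: In (2)(a) with c=0 both functions multiplying ν_j^0, ν_j^1 vanish and the claim fails (L=x_1+x_2, A_1=Υ+x, A_2=Υ is extremal); for c=0 they are replaced by a+2bx_j and (a+2bx_j)^3. The formula for c≠0 is unchanged. *)

(* Defs.v *)
From HB Require Import structures.
From mathcomp Require Import all_boot all_order all_algebra all_fingroup.
From mathcomp Require Import all_classical all_reals all_analysis.
Set Implicit Arguments.
Unset Strict Implicit.
Unset Printing Implicit Defensive.
Import Order.TTheory GRing.Theory Num.Theory.
Import numFieldNormedType.Exports.
Local Open Scope classical_set_scope.
Local Open Scope ring_scope.

Section TwistedOrthotoric.
Variables (R : realType) (m : nat).

(* An element of the m-th tensor power of R^2 (or of its dual), given by its
   components on the product basis; the basis vectors are indexed by maps
   e : 'I_m -> 'I_2. *)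
Definition tensor := {ffun {ffun 'I_m -> 'I_2} -> R^o}.

Definition vec2 (a b : R) : 'rV[R]_2 := \row_i (if i == ord0 then a else b).

Definition tprod (v : 'I_m -> 'rV[R]_2) : tensor :=
  [ffun e : {ffun 'I_m -> 'I_2} => \prod_(j < m) v j 0 (e j)].

(* On pure tensors this is the product of the pairings (u,v).(a,b) = ua + vb. *)
Definition tpair (S T : tensor) : R := \sum_e S e * T e.

(* h = S^m W^* as a subset of the tensor power: the inclusion phi of h is
   implicit in this encoding. *)
Definition symtensor : set tensor :=
  [set T | forall (s : 'S_m) (e : {ffun 'I_m -> 'I_2}),
             T [ffun j => e (s j)] = T e].

Definition tpow (a b : R) : tensor := tprod (fun=> vec2 a b).

Definition decomposes (T : tensor) :=
  exists t a b : R, [/\ t != 0, (a, b) != (0, 0) & T = t *: tpow a b].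

Definition mu (x : 'rV[R]_m) : tensor := tprod (fun j => vec2 1 (x 0 j)).

Definition mupair (alpha : tensor) (x : 'rV[R]_m) : R := tpair (mu x) alpha.

Definition Delta (j : 'I_m) (x : 'rV[R]_m) : R :=
  \prod_(s < m | s != j) (x 0 j - x 0 s).

Definition partial (j : 'I_m) (F : 'rV[R]_m -> R^o) : 'rV[R]_m -> R^o :=
  'D_(delta_mx 0 j) F.

Definition box (I : 'I_m -> set R) : set 'rV[R]_m :=
  [set x | forall j, I j (x 0 j)].

Definition open_interval (I : set R) := [/\ I !=set0, open I & is_interval I].

Definition smooth_on (I : set R) (f : R -> R) :=
  forall n x, I x -> derivable (derive1n n f) x 1.

(* The quadratic form of g_beta at x on the tangent vector (xdot, tdot), where
   tdot in t = h/<beta> is given by a representative tau in h. The value does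
   not depend on the representative, since <mu_beta, beta> = 1. *)
Definition metric (beta : tensor) (A : 'I_m -> R -> R) (x xdot : 'rV[R]_m)
    (tau : tensor) : R :=
  \sum_(j < m)
    (Delta j x / (A j (x 0 j) * mupair beta x) * xdot 0 j ^+ 2
     + A j (x 0 j) * mupair beta x / Delta j x
       * partial j (fun y => mupair tau y / mupair beta y) x ^+ 2).

Definition metric_posdef (beta : tensor) (I : 'I_m -> set R)
    (A : 'I_m -> R -> R) :=
  forall x xdot tau, box I x -> symtensor tau ->
    ~ (xdot = 0 /\ exists c : R, tau = c *: beta) ->
    0 < metric beta A x xdot tau.

(* The scalar curvature of g_beta is
     - \sum_j L^(m+2) / Delta_j * d_j^2 (A_j / L^(m+1)),   L = <mu, beta>,
   and the torus-invariant Killing potentials are the functions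
   <mu, alpha> / L with alpha in h. *)
Definition extremal (beta : tensor) (I : 'I_m -> set R) (A : 'I_m -> R -> R) :=
  exists2 alpha, symtensor alpha &
    forall x, box I x ->
      \sum_(j < m)
        mupair beta x ^+ (m + 3) / Delta j x
        * partial j (partial j
            (fun y => A j (y 0 j) / mupair beta y ^+ (m + 1))) x
      = mupair alpha x.

Definition second_antiderivative_on (I : set R) (f F : R -> R) :=
  forall x, I x ->
    [/\ derivable F x 1, derivable (derive1 F) x 1 & derive1n 2 F x = f x].

(* A_j = (a + b x)^(m+1) \iint U / (a + b x)^(m+3), the two constants of
   integration being free for each j. *)
Definition integral_form (I : 'I_m -> set R) (A : 'I_m -> R -> R) (a b : R) :=
  exists2 U : {poly R}, (size U <= m.+1)%N &
    forall j, exists2 F : R -> R,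
      second_antiderivative_on (I j)
        (fun x => U.[x] / (a + b * x) ^+ (m + 3)) F
      & forall x, I j x -> A j x = (a + b * x) ^+ (m + 1) * F x.

Definition case1 (beta : tensor) (I : 'I_m -> set R) (A : 'I_m -> R -> R) :=
  exists t a b : R,
    [/\ t != 0, (a, b) != (0, 0), beta = t *: tpow a b
      & integral_form I A a b].

Definition explicit_form_b_eq0 (I : 'I_m -> set R) (A : 'I_m -> R -> R) :=
  exists2 U : {poly R}, (size U <= m.+3)%N &
    exists nu0 nu1 : 'I_m -> R, forall j x, I j x ->
      A j x = U.[x] + nu0 j + nu1 j * x.

Definition explicit_form_b_neq0 (I : 'I_m -> set R) (A : 'I_m -> R -> R)
    (a b : R) :=
  exists2 U : {poly R}, (size U <= m.+1)%N &
    exists nu0 nu1 : 'I_m -> R, forall j x, I j x ->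
      A j x = U.[x] + (a + b * x) ^+ (m + 1) * (nu0 j + nu1 j * x).

(* A_j = U + nu0_j f0 + nu1_j f1 with U of degree at most 4, not depending
   on j. *)
Definition quartic_form (I : 'I_m -> set R) (A : 'I_m -> R -> R)
    (f0 f1 : R -> R) :=
  exists2 U : {poly R}, (size U <= 5)%N &
    exists nu0 nu1 : 'I_m -> R, forall j x, I j x ->
      A j x = U.[x] + nu0 j * f0 x + nu1 j * f1 x.

(* Since m = 2, \sum_j x_j and \prod_j x_j are x_1 + x_2 and x_1 x_2.

   The two functions of the case c != 0 vanish identically when c = 0 (then
   a c - b^2 = - b^2), although L = a + b (x_1 + x_2) still admits solutions
   with A_1 - A_2 outside 0: for L = x_1 + x_2 the pair A_1 = x, A_2 = 0 solves
   the equation of [extremal] with <mu, alpha> = 6. For c = 0 the two functions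
   are replaced by the powers 1 and 3 of a + 2 b x, which span the
   limit, as c tends to 0, of the space spanned by the two functions for
   c != 0. *)
Definition case2a (beta : tensor) (I : 'I_m -> set R) (A : 'I_m -> R -> R) :=
  m = 2%N /\
  exists a b c kappa : R,
    [/\ kappa != 0,
        forall x, mupair beta x =
          kappa * (a + b * (\sum_(j < m) x 0 j) + c * (\prod_(j < m) x 0 j)),
        c != 0 ->
          quartic_form I A
            (fun x => (b + c * x) * (a * c - b ^+ 2 + (b + c * x) ^+ 2))
            (fun x => (a * c - b ^+ 2) ^+ 2 - (b + c * x) ^+ 4)
      & c = 0 ->
          quartic_form I A
            (fun x => a + 2 * b * x) (fun x => (a + 2 * b * x) ^+ 3)].

Definition case2b (I : 'I_m -> set R) (A : 'I_m -> R -> R) :=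
  (3 <= m)%N /\
  exists2 U : {poly R}, (size U <= m.+3)%N &
    forall j x, I j x -> A j x = U.[x].

End TwistedOrthotoric.

(* Main.v *)
(* Write [L = <mu, beta>], a symmetric polynomial of degree at most one in each
   variable, and [brk_j A = L^2 A'' - 2 (m+1) L L_j A' + (m+1) (m+2) L_j^2 A].
   Extremality reads [\sum_j brk_j A_j / Delta_j = <mu, alpha>].

   A polynomial [U] of degree at most [m + 2], used for all [j], always solves
   this: expand [L] in products [\prod_r (z - x_r)] and [U] in powers
   [(y - x)^(m+2)] and sum residues.  Conversely, with all variables but [x_i]
   fixed, the equation is an ODE with polynomial right-hand side, which forces
   [A_i] to be a polynomial of degree at most [m + 2]; cancellation of the pole
   at [x_i = x_j] gives [brk_i (A_i - A_j) = 0] on [x_i = x_j].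
   If [L] is a product of equal linear forms, this says that [brk_i A_i], up to
   the common factor, does not depend on [i].  If [m = 2] it is an ODE solved by
   comparing coefficients.  If [m >= 3] and [C = A_i - A_j <> 0], it is, at each
   [x_i = x_j = z] with [C z <> 0], a nontrivial quadratic relation between
   [L] and [L_i] as functions of a third variable, so these are proportional;
   hence [L] has rank one in each pair of variables and decomposes. *)

Require Import Defs.
From HB Require Import structures.
From mathcomp Require Import all_boot all_order all_algebra all_fingroup.
From mathcomp Require Import all_classical all_reals all_analysis.
From mathcomp Require Import ring lra zify.
Import Order.TTheory GRing.Theory Num.Theory.
Import numFieldNormedType.Exports.
Local Open Scope classical_set_scope.
Local Open Scope ring_scope.

Set Implicit Arguments.
Unset Strict Implicit.
Unset Printing Implicit Defensive.

(** * Symmetric tensors and their polynomials *)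

Section Tensors.
Variables (R : realType) (m : nat).
Implicit Types (x : 'rV[R]_m) (al : tensor R m) (i j : 'I_m) (z u v : R).

Definition upd x j z : 'rV[R]_m := \row_i (if i == j then z else x 0 i).

Lemma updE x j z i : upd x j z 0 i = if i == j then z else x 0 i.
Proof. by rewrite mxE. Qed.

Lemma upd_eq x j z : upd x j z 0 j = z.
Proof. by rewrite updE eqxx. Qed.

Lemma upd_neq x j z i : i != j -> upd x j z 0 i = x 0 i.
Proof. by rewrite updE => /negPf->. Qed.

Lemma upd_id x j : upd x j (x 0 j) = x.
Proof. by apply/rowP => i; rewrite updE; case: eqP => [->|]. Qed.

Lemma upd_upd x j z u : upd (upd x j z) j u = upd x j u.
Proof. by apply/rowP => i; rewrite !updE; case: eqP. Qed.

Lemma updC x i j z u : i != j ->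
  upd (upd x i z) j u = upd (upd x j u) i z.
Proof.
move=> ij; apply/rowP => k; rewrite !updE.
by case: (eqVneq k j) => [->|//]; rewrite eq_sym (negPf ij).
Qed.

Lemma vec2E (a b : R) (k : 'I_2) :
  vec2 a b 0 k = if k == ord0 then a else b.
Proof. by rewrite mxE. Qed.

Lemma sum_vec2 (a b c d : R) :
  \sum_(k < 2) vec2 a b 0 k * vec2 c d 0 k = a * c + b * d.
Proof. by rewrite 2!big_ord_recl big_ord0 !vec2E /= addr0. Qed.

Lemma tpair_tprod (v w : 'I_m -> 'rV[R]_2) :
  tpair (tprod v) (tprod w) = \prod_j (\sum_k v j 0 k * w j 0 k).
Proof.
rewrite bigA_distr_bigA; apply: eq_bigr => e _.
by rewrite !ffunE -big_split.
Qed.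

Lemma mupair_tpow (a b : R) x :
  mupair (tpow m a b) x = \prod_j (a + b * x 0 j).
Proof.
rewrite /mupair tpair_tprod; apply: eq_bigr => j _.
by rewrite sum_vec2 mul1r mulrC.
Qed.

Lemma mupair0 x : mupair 0 x = 0.
Proof. by rewrite /mupair /tpair big1 // => e _; rewrite [X in _ * X]ffunE mulr0. Qed.

Lemma mupairD al al' x : mupair (al + al') x = mupair al x + mupair al' x.
Proof.
by rewrite /mupair /tpair -big_split; apply: eq_bigr => e _; rewrite [X in _ * X]ffunE mulrDr.
Qed.

Lemma mupairZ (c : R) al x : mupair (c *: al) x = c * mupair al x.
Proof.
rewrite /mupair /tpair mulr_sumr; apply: eq_bigr => e _.
by rewrite [X in _ * X]ffunE [LHS]mulrCA.
Qed.

Lemma mupairB al al' x : mupair (al - al') x = mupair al x - mupair al' x.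
Proof. by rewrite mupairD -scaleN1r mupairZ mulN1r. Qed.

(** Slot [j] of [mu] contributes either [1] or the coordinate to each component, so the pairing is
    affine in each variable. *)
Lemma mupair_upd al x j z : mupair al (upd x j z) =
  mupair al (upd x j 0) + z * (mupair al (upd x j 1) - mupair al (upd x j 0)).
Proof.
have H u : mupair al (upd x j u) =
    \sum_(e : {ffun 'I_m -> 'I_2}) vec2 1 u 0 (e j) *
      ((\prod_(i | i != j) vec2 1 (x 0 i) 0 (e i)) * al e).
  apply: eq_bigr => e _; rewrite !ffunE (bigD1 j) //= upd_eq -mulrA.
  by congr (_ * (_ * _)); apply: eq_bigr => i ij; rewrite upd_neq.
rewrite !H mulrBr !mulr_sumr -sumrB -big_split; apply: eq_bigr => e _ /=.
by rewrite !vec2E; case: ifP => _; ring.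
Qed.

Lemma mupair_perm al x (s : 'S_m) : symtensor al ->
  mupair al (\row_j x 0 (s j)) = mupair al x.
Proof.
move=> sal; rewrite /mupair /tpair.
have bij : bijective (fun e : {ffun 'I_m -> 'I_2} => [ffun j => e (s j)]).
  exists (fun e : {ffun 'I_m -> 'I_2} => [ffun j => e ((s^-1)%g j)]) => e;
  by apply/ffunP => j; rewrite !ffunE ?permK ?permKV.
rewrite (reindex _ (onW_bij _ bij)) /=; apply: eq_bigr => e _.
rewrite sal !ffunE; congr (_ * _).
rewrite [RHS](reindex_inj (@perm_inj _ s)) /=.
by apply: eq_bigr => j _; rewrite mxE ffunE.
Qed.

Lemma mupair_swap al x i j u v : symtensor al ->
  i != j -> mupair al (upd (upd x i u) j v) = mupair al (upd (upd x i v) j u).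
Proof.
move=> sal ij; rewrite -(mupair_perm _ (tperm i j) sal); congr mupair.
apply/rowP => k; rewrite mxE !updE.
case: tpermP => [->|->|/eqP ki /eqP kj]; rewrite ?eqxx ?(negPf ij) //.
by rewrite (negPf ki) (negPf kj).
Qed.

(** The vectors [(1, z)] span the plane, since [(0, 1) = (1, 1) - (1, 0)]. Induction on the number
    [k] of slots already filled by basis vectors reduces the components of [al] to values of the
    pairing. *)
Lemma mupair_inj al : (forall x, mupair al x = 0) -> al = 0.
Proof.
move=> al0; apply/ffunP => e; rewrite [RHS]ffunE.
suff H k (v : 'I_m -> 'rV[R]_2) :
    (forall i, (i < k)%N -> v i = vec2 1 0 \/ v i = vec2 0 1) ->
    (forall i, (k <= i)%N -> exists z, v i = vec2 1 z) ->
    tpair (tprod v) al = 0.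
  rewrite -(H m (fun i => if e i == ord0 then vec2 1 0 else vec2 0 1)) => [|i _|i].
  - rewrite /tpair (bigD1 e) //= big1 => [|e' ee'].
      rewrite ffunE big1 => [|i _]; first by rewrite mul1r addr0.
      by case: ifP => ei; rewrite vec2E ei.
    have /existsP[i ei] : [exists i, e' i != e i].
      rewrite -[X in is_true X]negbK negb_exists; apply: contra ee' => /forallP H'.
      by apply/eqP/ffunP => i; have := H' i; rewrite negbK => /eqP.
    rewrite ffunE (bigD1 i) //= [X in X * _](_ : _ = 0) ?mul0r //.
    have o2 (a : 'I_2) : a = ord0 \/ a = ord_max.
      by case: a => -[|[|//]] ?; [left|right]; apply/val_inj.
    by case: (o2 (e i)) (o2 (e' i)) ei => -> [->|->]; rewrite //= vec2E /= mul0r.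
  - by case: ifP; [left|right].
  - by rewrite leqNgt ltn_ord.
elim: k v => [|k IH] v v1 v2.
  have [z zE] : exists z : 'I_m -> R, forall i, v i = vec2 1 (z i).
    have H i : {z | v i = vec2 1 z} by apply/cid/v2.
    by exists (fun i => sval (H i)) => i; case: (H i).
  rewrite -[RHS](al0 (\row_i z i)); congr tpair; congr tprod.
  by apply: funext => i; rewrite zE mxE.
have [km|mk] := ltnP k m; last first.
  apply: IH => [i ik|i ki]; first by apply: v1; rewrite ltnW.
  by move: (leq_trans mk ki); rewrite leqNgt ltn_ord.
pose w (u : 'rV[R]_2) (i : 'I_m) := if i == Ordinal km then u else v i.
have tw (u : 'rV[R]_2) : tpair (tprod (w u)) al =
    \sum_(e : {ffun 'I_m -> 'I_2}) u 0 (e (Ordinal km)) *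
      ((\prod_(i | i != Ordinal km) v i 0 (e i)) * al e).
  apply: eq_bigr => e' _; rewrite !ffunE (bigD1 (Ordinal km)) //= /w eqxx -mulrA.
  by congr (_ * (_ * _)); apply: eq_bigr => i /negPf ->.
have Hw z : tpair (tprod (w (vec2 1 z))) al = 0.
  apply: IH => i ik; rewrite /w.
    case: eqP => [ie|_]; last by apply: v1; rewrite ltnW.
    by move: ik; rewrite ie ltnn.
  case: eqP => [_|/eqP ie]; first by exists z.
  by apply: v2; rewrite ltn_neqAle ik andbT; apply: contra ie => /eqP ki; apply/eqP/val_inj.
have -> : v = w (v (Ordinal km)) by apply: funext => i; rewrite /w; case: eqP => [->|].
case: (v1 (Ordinal km)) => // ->; first exact: Hw.
transitivity (tpair (tprod (w (vec2 1 1))) al - tpair (tprod (w (vec2 1 0))) al); last first.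
  by rewrite !Hw subr0.
rewrite !tw -sumrB; apply: eq_bigr => e' _; rewrite -mulrBl; congr (_ * _).
by rewrite !vec2E; case: ifP; rewrite ?subrr ?subr0.
Qed.

Lemma symtensor_tpow (a b : R) : symtensor (tpow m a b).
Proof.
move=> s e; rewrite !ffunE [RHS](reindex_inj (@perm_inj _ s)) /=.
by apply: eq_bigr => j _; rewrite ffunE.
Qed.

Lemma symtensor0 : symtensor (0 : tensor R m).
Proof. by move=> s e; rewrite !ffunE. Qed.

Lemma symtensorD al al' : symtensor al -> symtensor al' -> symtensor (al + al').
Proof. by move=> sal sal' s e; rewrite !ffunE sal sal'. Qed.

Lemma symtensorZ (c : R) al : symtensor al -> symtensor (c *: al).
Proof. by move=> sal s e; rewrite !ffunE sal. Qed.

(** Index maps with equally many nonzero values differ by a permutation of the slots. *)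
Lemma symtensorE al (e e' : {ffun 'I_m -> 'I_2}) : symtensor al ->
  #|[pred j | e j != ord0]| = #|[pred j | e' j != ord0]| -> al e = al e'.
Proof.
move=> sal ee'.
have o2 (a : 'I_2) : a = ord0 \/ a = ord_max.
  by case: a => -[|[|//]] ?; [left|right]; apply/val_inj.
have cnt (f : {ffun 'I_m -> 'I_2}) :
    count (fun j => f j != ord0) (enum 'I_m) = #|[pred j | f j != ord0]|.
  by rewrite enumT cardE -size_filter [X in _ = size X]/enum_mem; congr size; apply: eq_filter.
have cnt0 (f : {ffun 'I_m -> 'I_2}) :
    count (fun j => f j == ord0) (enum 'I_m) = (m - #|[pred j | f j != ord0]|)%N.
  rewrite -cnt -[X in (X - _)%N](card_ord m) cardE.
  by rewrite -(count_predC (fun j => f j == ord0)) addnK.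
have : perm_eq [tuple e j | j < m] [tuple e' j | j < m].
  rewrite /perm_eq; apply/allP => a _ /=; rewrite !count_map.
  case: (o2 a) => ->.
    by have := congr1 (subn m) ee'; rewrite -!cnt0 !enumT => E; apply/eqP.
  have max0 (f : {ffun 'I_m -> 'I_2}) :
      preim f (pred1 ord_max) =1 (fun j => f j != ord0).
    by move=> j /=; case: (o2 (f j)) => ->.
  by rewrite -!enumT !(eq_count (max0 _)) !cnt ee'.
case/tuple_permP => p pE; rewrite -(sal p e'); congr (al _); apply/ffunP => j.
have := congr1 (fun t => nth (e j) t j) pE.
by rewrite -!tnth_nth !tnth_mktuple ffunE.
Qed.
End Tensors.

(** * Lagrange interpolation *)

Section Vandermonde.
Variable R : realType.

Lemma vandermonde_solve n (z b : 'I_n -> R) : injective z ->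
  exists c : 'I_n -> R, forall l : 'I_n, b l = \sum_k c k * z k ^+ l.
Proof.
move=> zinj; pose V := Vandermonde n (\row_k z k).
have uV : V \in unitmx.
  rewrite unitmxE unitfE det_Vandermonde; apply/prodf_neq0 => i _.
  apply/prodf_neq0 => j ij; rewrite !mxE subr_eq0; apply/eqP => /zinj ji.
  by rewrite ji ltnn in ij.
pose c := invmx V *m \col_l b l.
exists (fun k => c k 0) => l.
have : (V *m c) l 0 = b l by rewrite mulKVmx // mxE.
by move=> <-; rewrite mxE; apply: eq_bigr => k _; rewrite !mxE mulrC.
Qed.


(** Up to signs and nonzero binomials the coefficients of [(z_k - X)^n] are powers of [z_k], so the
    system for [c] is a Vandermonde system. *)
Lemma span_pow n (z : 'I_n.+1 -> R) (U : {poly R}) : injective z ->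
  (size U <= n.+1)%N ->
  exists c : 'I_n.+1 -> R, U = \sum_k c k *: ((z k)%:P - 'X) ^+ n.
Proof.
move=> zinj sU.
have [c cE] := vandermonde_solve
  (fun l : 'I_n.+1 => U`_(n - l) * (-1) ^+ (n - l) / 'C(n, l)%:R) zinj.
exists c; apply/polyP => l; rewrite coef_sum.
have coefE k : (((z k)%:P - 'X) ^+ n)`_l =
    if (l < n.+1)%N then (-1) ^+ l * 'C(n, n - l)%:R * z k ^+ (n - l) else 0.
  rewrite exprBn coef_sum; case: ifP => ln.
    rewrite (bigD1 (Ordinal ln)) //= big1 => [|i il].
      rewrite addr0 coefMn -mulrA -!rmorphXn /= -polyCN -rmorphXn coefCM coefCM.
      by rewrite coefXn eqxx bin_sub // -[_ *+ 'C(n, l)]mulr_natr !mulr1 mulrAC.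
    rewrite coefMn -mulrA -!rmorphXn /= -polyCN -rmorphXn coefCM coefCM coefXn.
    case: eqP => [li|_]; rewrite ?mulr0 ?mul0rn //.
    by case/eqP: il; apply/val_inj.
  rewrite big1 // => i _.
  rewrite coefMn -mulrA -!rmorphXn /= -polyCN -rmorphXn coefCM coefCM coefXn.
  case: eqP => [li|_]; rewrite ?mulr0 ?mul0rn //.
  by rewrite li ltn_ord in ln.
have [ln|ln] := ltnP l n.+1; last first.
  rewrite (leq_sizeP _ _ sU) // big1 // => k _.
  by rewrite coefZ coefE ltnNge ln /= mulr0.
have nl : (n - l < n.+1)%N by rewrite ltnS leq_subr.
have := cE (Ordinal nl) => /=; rewrite subKn // => E.
have Cn0 : 'C(n, n - l)%:R != 0 :> R by rewrite pnatr_eq0 -lt0n bin_gt0 leq_subr.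
have -> : U`_l = (-1) ^+ l * 'C(n, n - l)%:R * (U`_l * (-1) ^+ l / 'C(n, n - l)%:R).
  rewrite [RHS](_ : _ = U`_l *
    (((-1) ^+ l * (-1) ^+ l) * ('C(n, n - l)%:R / 'C(n, n - l)%:R))).
    by rewrite -expr2 sqrr_sign divff // !mulr1.
  by ring.
rewrite E mulr_sumr; apply: eq_bigr => k _.
by rewrite coefZ coefE ln; ring.
Qed.

(** The component of [tpow m z (-1)] at an index map with [q] nonzero values is [(-1)^q z^(m-q)],
    which again gives a Vandermonde system. As functions of [x], these tensors are the products
    [\prod_r (z_k - x_r)]. *)
Lemma span_tpow m (al : tensor R m) (z : 'I_m.+1 -> R) : symtensor al ->
  injective z -> exists c : 'I_m.+1 -> R, al = \sum_k c k *: tpow m (z k) (-1).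
Proof.
move=> sal zinj.
pose el l : {ffun 'I_m -> 'I_2} := [ffun j : 'I_m => if (j < l)%N then ord0 else ord_max].
have elE l : (l <= m)%N -> #|[pred j | el l j != ord0]| = (m - l)%N.
  move=> lm; rewrite -[X in (X - _)%N](card_ord m) -(cardC [pred j : 'I_m | (j < l)%N]).
  have -> : #|[pred j : 'I_m | (j < l)%N]| = l.
    have finj : injective (widen_ord lm) by move=> k k' /(congr1 val) /= kk; apply/val_inj.
    rewrite -[RHS](card_ord l) -(fintype.card_image finj 'I_l).
    apply: eq_card => j; rewrite !inE.
    apply/idP/fintype.imageP => [jl|[k _ ->]]; last exact: (ltn_ord k).
    by exists (Ordinal jl) => //; apply/val_inj.
  rewrite addKn; apply: eq_card => j; rewrite !inE ffunE.
  by case: ifP.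
have [c cE] := vandermonde_solve
  (fun l : 'I_m.+1 => al (el l) * (-1) ^+ (m - l)) zinj.
exists c; apply/ffunP => e; rewrite sum_ffunE.
pose q := #|[pred j | e j != ord0]|.
have qm : (q <= m)%N by rewrite -[X in (_ <= X)%N](card_ord m) max_card.
have lm : (m - q < m.+1)%N by rewrite ltnS leq_subr.
have -> : al e = al (el (m - q)%N).
  by apply: symtensorE => //; rewrite elE ?leq_subr // subKn.
have := cE (Ordinal lm) => /=; rewrite subKn // => E.
have -> : al (el (m - q)%N) = al (el (m - q)%N) * (-1) ^+ q * (-1) ^+ q.
  by rewrite -mulrA -expr2 sqrr_sign mulr1.
rewrite E mulr_suml; apply: eq_bigr => k _.
rewrite !ffunE (bigID [pred j | e j != ord0]) /=.
rewrite (eq_bigr (fun _ => -1)) => [|j /negPf ej]; last by rewrite vec2E ej.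
rewrite [X in _ = _ *: (_ * X)](eq_bigr (fun _ => z k)) => [|j]; last first.
  by rewrite negbK vec2E => ->.
rewrite !prodr_const -/q -mulrA [_ *: _]/(_ * _); congr (_ * _); rewrite mulrC.
congr (_ * _ ^+ _).
rewrite -[m in LHS](card_ord m) -(cardC [pred j | e j != ord0]) addKn.
by apply: eq_card => j; rewrite !inE.
Qed.
End Vandermonde.

Lemma size_prod_XsubC_cond (R : realType) (I : finType) (P : pred I) (x : I -> R) :
  size (\prod_(i | P i) ('X - (x i)%:P)) = #|P|.+1.
Proof. by rewrite -big_enum size_prod_XsubC -cardE. Qed.

Lemma card_neq m (j : 'I_m) : #|(fun r => r != j)|.+1 = m.
Proof. by rewrite (cardC1 j) card_ord prednK // (leq_ltn_trans _ (ltn_ord j)). Qed.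

Lemma size_subX_exp (R : realType) (z : R) n : (size ((z%:P - 'X) ^+ n)%R <= n.+1)%N.
Proof.
rewrite (leq_trans (size_poly_exp_leq _ _)) //.
by rewrite -opprB size_polyN size_XsubC mul1n.
Qed.

Section Lagrange.
Variables (R : realType) (m : nat).
Implicit Types (x : 'rV[R]_m) (i j : 'I_m).

Lemma Delta_inj x : (forall j, Delta j x != 0) -> injective (fun j => x 0 j).
Proof.
move=> Dx i j ij; apply/eqP; apply/negP => /negP ji.
have /prodf_neq0 := Dx i; move/(_ j); rewrite eq_sym ji => /(_ isT).
by rewrite ij subrr eqxx.
Qed.

(* The residues of [(z - t) ^ m / ((z1 - t) (z2 - t) \prod_r (t - x_r))] sum to
   zero; both sides are polynomials in [z2], compared at the points [x_r] and
   [z1]. *)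
Lemma lagrange_pole x (z z1 z2 : R) : (forall j, Delta j x != 0) ->
  (z1 - z2) * (\sum_j (z - x 0 j) ^+ m * (\prod_(r | r != j) (z1 - x 0 r))
      * (\prod_(r | r != j) (z2 - x 0 r)) / Delta j x) =
  (z - z2) ^+ m * (\prod_r (z1 - x 0 r)) - (z - z1) ^+ m * (\prod_r (z2 - x 0 r)).
Proof.
move=> Dx; have xinj := Delta_inj Dx.
have Ei i j : i != j -> \prod_(r | r != j) (x 0 i - x 0 r) = 0.
  by move=> ij; rewrite (bigD1 i) //= subrr mul0r.
have E i : \prod_r (x 0 i - x 0 r) = 0 by rewrite (bigD1 i) //= subrr mul0r.
(* If [z1] is some [x_i], only the [i]-th summand survives. Otherwise the points of [rs] are
   distinct, and these [m + 1] roots force a polynomial of degree at most [m] to vanish. *)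
have [/existsP[i /eqP z1E]|/negP z1x] := boolP [exists i, z1 == x 0 i].
  rewrite z1E E mulr0 sub0r (bigD1 i) //= [X in _ * (_ + X)]big1 => [|j ji]; last first.
    by rewrite Ei 1?eq_sym // mulr0 !mul0r.
  rewrite addr0 -[X in _ * (_ * X * _ / _)]/(Delta i x) [in RHS](bigD1 i) //=.
  by field.
pose p : {poly R} := (z1%:P - 'X) * (\sum_j
      ((z - x 0 j) ^+ m * (\prod_(r | r != j) (z1 - x 0 r)) / Delta j x)
      *: \prod_(r | r != j) ('X - (x 0 r)%:P))
   - (\prod_r (z1 - x 0 r)) *: (z%:P - 'X) ^+ m
   + (z - z1) ^+ m *: \prod_r ('X - (x 0 r)%:P).
have pE t : p.[t] = (z1 - t) * (\sum_j (z - x 0 j) ^+ m * (\prod_(r | r != j) (z1 - x 0 r))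
      * (\prod_(r | r != j) (t - x 0 r)) / Delta j x) -
  ((z - t) ^+ m * (\prod_r (z1 - x 0 r)) - (z - z1) ^+ m * (\prod_r (t - x 0 r))).
  rewrite /p !hornerE horner_sum horner_prod.
  rewrite -addrA; congr (_ * _ + _).
    apply: eq_bigr => j _; rewrite hornerZ horner_prod.
    rewrite [in RHS]mulrAC; congr (_ * _); apply: eq_bigr => r _; by rewrite !hornerE.
  rewrite opprB addrC [_ * (z - t) ^+ _]mulrC; congr (_ * _ - _).
  by apply: eq_bigr => r _; rewrite !hornerE.
have sE j : size (\prod_(r | r != j) ('X - (x 0 r)%:P)) = m.
  by rewrite size_prod_XsubC_cond card_neq.
suff p0 : p = 0 by apply/eqP; rewrite -subr_eq0 -pE p0 horner0.
pose rs := z1 :: [seq x 0 j | j <- enum 'I_m].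
apply: (@roots_geq_poly_eq0 _ p rs).
- rewrite /= {1}/root pE subrr mul0r sub0r opprB subrr eqxx /=.
  apply/allP => _ /mapP[i _ ->]; rewrite /root pE E mulr0 subr0.
  rewrite (bigD1 i) //= [X in _ * (_ + X)]big1 => [|j ji]; last first.
    by rewrite Ei 1?eq_sym // !mulr0 mul0r.
  rewrite addr0 -[X in _ * (_ * X / _)]/(Delta i x) [\prod_r _](bigD1 i) //=.
  by rewrite subr_eq0; apply/eqP; field.
- rewrite /= map_inj_uniq ?enum_uniq // andbT; apply/mapP => -[i _ z1i].
  by apply: z1x; apply/existsP; exists i; rewrite z1i.
- rewrite /= size_map size_enum_ord.
  rewrite (leq_trans (size_polyD _ _)) // geq_max.
  rewrite [X in _ && X](leq_trans (size_scale_leq _ _)); last first.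
    by rewrite size_prod_XsubC_cond card_ord.
  rewrite andbT (leq_trans (size_polyD _ _)) // geq_max size_polyN.
  rewrite [X in _ && X](leq_trans (size_scale_leq _ _)) ?size_subX_exp // andbT.
  rewrite (leq_trans (size_polyMleq _ _)) // -opprB size_polyN size_XsubC /=.
  rewrite ltnS (leq_trans (size_sum _ _ _)) //; apply/bigmax_leqP => j _.
  by rewrite (leq_trans (size_scale_leq _ _)) ?sE.
Qed.
End Lagrange.

(** * The extremal equation: polynomial solutions *)

(** Polarization of the bracket in the pair [(L, Q)]: it is symmetric and bilinear, so the two
    copies of [L] can be expanded independently. *)
Definition brk2 (T : comNzRingType) n (L L' Q Q' A0 A1 A2 : T) :=
  L * L' * A2 - n%:R * (L * Q' + Q * L') * A1 + (n * n.+1)%:R * (Q * Q') * A0.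

(* For [L] affine of slope [Q]: [L^(n+2) (A / L^n)''], where [A0], [A1], [A2]
   are [A], [A'], [A'']. *)
Definition brk (T : comNzRingType) n (L Q A0 A1 A2 : T) :=
  brk2 n L L Q Q A0 A1 A2.

(** The partial derivative of the pairing in [x_j], written as a difference because the pairing is
    affine in [x_j]. *)
Definition slope (R : realType) m (al : tensor R m) (j : 'I_m) (x : 'rV[R]_m) :=
  mupair al (upd x j 1) - mupair al (upd x j 0).

Section PolynomialSolutions.
Variables (R : realType) (m : nat).
Implicit Types (x : 'rV[R]_m) (i j : 'I_m) (al be : tensor R m).

Lemma mupair_sum (I : finType) (c : I -> R) (F : I -> tensor R m) x :
  mupair (\sum_k c k *: F k) x = \sum_k c k * mupair (F k) x.
Proof.
elim/big_rec2: _ => [|k y T _ <-]; first exact: mupair0.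
by rewrite mupairD mupairZ.
Qed.

Lemma slope_sum (I : finType) (c : I -> R) (F : I -> tensor R m) j x :
  slope (\sum_k c k *: F k) j x = \sum_k c k * slope (F k) j x.
Proof. by rewrite /slope !mupair_sum -sumrB; apply: eq_bigr => k _; ring. Qed.

Lemma mupair_affine al x j z : mupair al (upd x j z) =
  mupair al (upd x j 0) + z * slope al j x.
Proof. exact: mupair_upd. Qed.

Lemma slope_upd al x j z : slope al j (upd x j z) = slope al j x.
Proof. by rewrite /slope !upd_upd. Qed.

Lemma mupair_tpowD (a b : R) j x : mupair (tpow m a b) x =
  (a + b * x 0 j) * \prod_(r | r != j) (a + b * x 0 r).
Proof. by rewrite mupair_tpow (bigD1 j). Qed.

Lemma slope_tpow (a b : R) j x : slope (tpow m a b) j x =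
  b * \prod_(r | r != j) (a + b * x 0 r).
Proof.
rewrite /slope !(mupair_tpowD _ _ j) !upd_eq.
have E z : \prod_(r | r != j) (a + b * upd x j z 0 r) =
    \prod_(r | r != j) (a + b * x 0 r).
  by apply: eq_bigr => r rj; rewrite upd_neq.
by rewrite !E; ring.
Qed.

(** Equality is asked only where the [x_j] are distinct, so that the quotients by [Delta] are
    genuine and not default values of division by zero. *)
Definition potential (F : 'rV[R]_m -> R) :=
  exists2 al, symtensor al &
    forall x, (forall j, Delta j x != 0) -> F x = mupair al x.

Lemma potential0 : potential (fun=> 0).
Proof. by exists 0 => [|x _]; [exact: symtensor0 | rewrite mupair0]. Qed.

Lemma potentialD F G : potential F -> potential G -> potential (F \+ G).
Proof.
move=> [al sal alE] [al' sal' alE']; exists (al + al') => [|x Dx].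
  exact: symtensorD.
by rewrite mupairD -alE // -alE'.
Qed.

Lemma potentialZ c F : potential F -> potential (fun x => c * F x).
Proof.
move=> [al sal alE]; exists (c *: al) => [|x Dx]; first exact: symtensorZ.
by rewrite mupairZ -alE.
Qed.

Lemma potential_sum (I : finType) (c : I -> R) (F : I -> 'rV[R]_m -> R) :
  (forall k, potential (F k)) -> potential (fun x => \sum_k c k * F k x).
Proof.
move=> FP; have -> : (fun x => \sum_k c k * F k x) = \sum_k (fun x => c k * F k x).
  by apply: funext => x; rewrite fct_sumE.
elim/big_rec: _ => [|k y _ yP]; first exact: potential0.
by apply: potentialD => //; apply: potentialZ.
Qed.

Lemma brk2_suml (I : finType) (c : I -> R) n (L Q : I -> R) L' Q' A0 A1 A2 :
  brk2 n (\sum_k c k * L k) L' (\sum_k c k * Q k) Q' A0 A1 A2 =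
  \sum_k c k * brk2 n (L k) L' (Q k) Q' A0 A1 A2.
Proof.
set u := \sum_k _ * L k; set v := \sum_k _ * Q k.
transitivity (u * (L' * A2 - n%:R * Q' * A1)
   + v * ((n * n.+1)%:R * Q' * A0 - n%:R * L' * A1)); first by rewrite /brk2; ring.
rewrite !mulr_suml -big_split; apply: eq_bigr => k _ /=.
by rewrite /brk2; ring.
Qed.

Lemma brk2C n (L L' Q Q' A0 A1 A2 : R) :
  brk2 n L L' Q Q' A0 A1 A2 = brk2 n L' L Q' Q A0 A1 A2.
Proof. by rewrite /brk2; ring. Qed.

Lemma brk2_sumA (I : finType) (c : I -> R) n (L L' Q Q' : R) (A0 A1 A2 : I -> R) :
  brk2 n L L' Q Q' (\sum_k c k * A0 k) (\sum_k c k * A1 k) (\sum_k c k * A2 k) =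
  \sum_k c k * brk2 n L L' Q Q' (A0 k) (A1 k) (A2 k).
Proof.
rewrite /brk2 !mulr_sumr -sumrN -!big_split; apply: eq_bigr => k _ /=.
by ring.
Qed.

Definition polybrk n (L Q : R) (U : {poly R}) (t : R) :=
  brk n L Q U.[t] U^`().[t] U^`()^`().[t].

Lemma horner_sum_subX_exp N (c z : 'I_N -> R) n t :
  [/\ (\sum_k c k *: ((z k)%:P - 'X) ^+ n.+2).[t] = \sum_k c k * (z k - t) ^+ n.+2,
      (\sum_k c k *: ((z k)%:P - 'X) ^+ n.+2)^`().[t] =
        \sum_k c k * (- n.+2%:R * (z k - t) ^+ n.+1) &
      (\sum_k c k *: ((z k)%:P - 'X) ^+ n.+2)^`()^`().[t] =
        \sum_k c k * (n.+2%:R * n.+1%:R * (z k - t) ^+ n)].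
Proof.
have dE (w : R) k : ((w%:P - 'X) ^+ k.+1)^`() = - k.+1%:R *: (w%:P - 'X) ^+ k.
  by rewrite deriv_exp derivB derivC derivX sub0r mulN1r scaleNr scaler_nat mulNrn.
split; rewrite ?(raddf_sum deriv) /= ?horner_sum.
- by apply: eq_bigr => k _; rewrite !hornerE.
- by apply: eq_bigr => k _; rewrite derivZ dE !hornerE.
- under [in LHS]eq_bigr => k _ do rewrite derivZ dE.
  apply: eq_bigr => k _.
  by rewrite !derivZ dE !hornerE /=; ring.
Qed.

(* For [L = \prod_r (z1 - x_r)], [L' = \prod_r (z2 - x_r)], [A = (y - x)^(m+2)]
   the polarized bracket is, up to a constant, [(z1 - y) (z2 - y) (y - x_j)^m]
   times the products over [r != j], so that [lagrange_pole] applies. Disjoint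
   sets of nodes are used for the two copies of [L] to avoid [z1 = z2]. *)
Lemma potential_polybrk be (U : {poly R}) : symtensor be -> (size U <= m.+3)%N ->
  potential (fun x => \sum_j
    polybrk m.+1 (mupair be x) (slope be j x) U (x 0 j) / Delta j x).
Proof.
move=> sbe sU.
have natinj N : injective (fun k : 'I_N => k%:R : R).
  by move=> k l /eqP; rewrite eqr_nat => /eqP /val_inj.
have neginj N : injective (fun k : 'I_N => - k.+1%:R : R).
  by move=> k l /oppr_inj /eqP; rewrite eqr_nat eqSS => /eqP /val_inj.
have [c cE] := span_tpow sbe (natinj _).
have [c' c'E] := span_tpow sbe (neginj _).
have [d ->] := span_pow (natinj _) sU.
set z := fun k : 'I_m.+1 => k%:R : R in cE.
set z' := fun k : 'I_m.+1 => - k.+1%:R : R in c'E.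
set y := fun k : 'I_m.+3 => k%:R : R.
have zz k l : z k - z' l != 0.
  by rewrite /z /z' opprK -natrD pnatr_eq0 addnS.
pose G k l q x := \sum_j brk2 m.+1
   (mupair (tpow m (z k) (-1)) x) (mupair (tpow m (z' l) (-1)) x)
   (slope (tpow m (z k) (-1)) j x) (slope (tpow m (z' l) (-1)) j x)
   ((y q - x 0 j) ^+ m.+2) (- m.+2%:R * (y q - x 0 j) ^+ m.+1)
   (m.+2%:R * m.+1%:R * (y q - x 0 j) ^+ m) / Delta j x.
(* The bracket is linear in each copy of [L] and in [U], which leaves one product for each copy and
   one power for [U]. *)
suff PG k l q : potential (G k l q).
  have [al sal alE] := potential_sum c (fun k => potential_sum c' (fun l =>
     potential_sum d (fun q => PG k l q))).
  exists al => // x Dx; rewrite -alE //.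
  under [RHS]eq_bigr => k _ do (under eq_bigr => l _ do
    (under eq_bigr => q _ do rewrite mulr_sumr; rewrite exchange_big mulr_sumr);
    rewrite exchange_big mulr_sumr).
  rewrite exchange_big; apply: eq_bigr => j _.
  have [H0 H1 H2] := horner_sum_subX_exp d y m (x 0 j).
  rewrite /polybrk H0 H1 H2 /brk {1 3}cE c'E !mupair_sum !slope_sum brk2_suml mulr_suml.
  apply: eq_bigr => k _; rewrite brk2C brk2_suml mulr_sumr mulr_suml mulr_sumr.
  apply: eq_bigr => l _; rewrite brk2C brk2_sumA !mulr_sumr mulr_suml.
  by apply: eq_bigr => q _; ring.
(* The right-hand side of [lagrange_pole] divided by [z k - z' l], times the factor of the bracket
   that does not depend on [x]. *)
exists (((m.+1 * m.+2)%:R * (z k - y q) * (z' l - y q) / (z k - z' l)) *: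
   ((y q - z' l) ^+ m *: tpow m (z k) (-1) + - (y q - z k) ^+ m *: tpow m (z' l) (-1))).
  by apply/symtensorZ/symtensorD; apply/symtensorZ/symtensor_tpow.
move=> x Dx; rewrite mupairZ mupairD !mupairZ !mupair_tpow.
have sE w (i : 'I_m) : w + -1 * x 0 i = w - x 0 i by rewrite mulN1r.
under [X in _ * (_ * X + _)]eq_bigr => i _ do rewrite sE.
under [X in _ * (_ + _ * X)]eq_bigr => i _ do rewrite sE.
rewrite mulNr -(lagrange_pole (y q) (z k) (z' l) Dx) mulrA mulfVK //.
rewrite mulr_sumr; apply: eq_bigr => j _.
rewrite !(mupair_tpowD _ _ j) !slope_tpow !sE.
under [\prod_(_ < _ | _) (z k + _)]eq_bigr => i _ do rewrite sE.
under [\prod_(_ < _ | _) (z' l + _)]eq_bigr => i _ do rewrite sE.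
by rewrite /brk2 !natrM !exprSr; field.
Qed.
End PolynomialSolutions.

(** * Calculus *)

Section Calculus.
Variable R : realType.
Implicit Types (I : set R) (f g : R -> R).

(** The derivatives are separate functions constrained only on [I], so that analytic and formal
    derivatives can be exchanged. *)
Definition derivs2 I f f1 f2 :=
  forall x : R, I x -> is_derive x (1 : R) f (f1 x : R) /\ is_derive x (1 : R) f1 (f2 x : R).

Lemma derivs2_smooth I f : smooth_on I f -> derivs2 I f (derive1 f) (derive1n 2 f).
Proof.
move=> sf x Ix; have H n : is_derive x 1 (derive1n n f) (derive1n n.+1 f x).
  by apply: DeriveDef; [exact: sf | rewrite derive1nS derive1E].
by split; [exact: (H 0%N) | exact: (H 1%N)].
Qed.

Lemma derivs2_horner I (U : {poly R}) :
  derivs2 I (horner U) (horner U^`()) (horner U^`()^`()).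
Proof. by move=> x _; split; exact: is_derive_poly. Qed.

Lemma derivs2B I f f1 f2 g g1 g2 : derivs2 I f f1 f2 -> derivs2 I g g1 g2 ->
  derivs2 I (f \- g) (f1 \- g1) (f2 \- g2).
Proof.
by move=> Hf Hg x Ix; have [? ?] := Hf x Ix; have [? ?] := Hg x Ix; split; exact: is_deriveB.
Qed.

Lemma near_open I x (P : R -> Prop) : open I -> I x -> (forall y, I y -> P y) ->
  \forall y \near x, P y.
Proof.
by move=> oI Ix IP; near=> y; apply: IP; near: y; exact: open_nbhs_nbhs.
Unshelve. all: by end_near. Qed.

Lemma derivs2_ext I f f1 f2 g : open I -> {in I, f =1 g} ->
  derivs2 I f f1 f2 -> derivs2 I g f1 f2.
Proof.
move=> oI fg Hf x Ix; have [Hf1 Hf2] := Hf x Ix; split => //.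
apply: near_eq_is_derive Hf1; apply: near_open oI Ix _ => y Iy.
by apply: fg; rewrite inE.
Qed.

Lemma derivs2E I f f1 f2 x : open I -> derivs2 I f f1 f2 -> I x ->
  [/\ derivable f x 1, derivable (derive1 f) x 1 & derive1n 2 f x = f2 x].
Proof.
move=> oI Hf Ix; have [Hf1 Hf2] := Hf x Ix.
have f1E : \forall y \near x, f1 y = derive1 f y.
  apply: near_open oI Ix _ => y Iy; have [Hy _] := Hf y Iy.
  by rewrite derive1E derive_val.
have H : is_derive x 1 (derive1 f) (f2 x) by exact: near_eq_is_derive Hf2.
by split; [case: Hf1 | case: H | rewrite derive1nS derive1E derive1n1 derive_val].
Qed.

Lemma derivs2_quot I f f1 f2 (a b : R) n : derivs2 I f f1 f2 ->
  (forall x, I x -> a + b * x != 0) ->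
  derivs2 I (fun z => f z / (a + b * z) ^+ n)
    (fun z => f1 z / (a + b * z) ^+ n - n%:R * b * f z / (a + b * z) ^+ n.+1)
    (fun z => brk n (a + b * z) b (f z) (f1 z) (f2 z) / (a + b * z) ^+ n.+2).
Proof.
move=> Hf L0.
have quot k g (g1 x : R) : I x -> is_derive x 1 g g1 ->
    is_derive x 1 (fun z => g z / (a + b * z) ^+ k)
      (g1 / (a + b * x) ^+ k - k%:R * b * g x / (a + b * x) ^+ k.+1).
  move=> Ix gx.
  have HL : is_derive x (1 : R) (fun z : R => (a + b * z) ^+ k)
      (k%:R * b * (a + b * x) ^+ k.-1).
    have -> : (fun z : R => (a + b * z) ^+ k) = horner ((a%:P + b *: 'X) ^+ k).
      by apply: funext => z; rewrite !hornerE.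
    apply: is_derive_eq.
    rewrite deriv_exp derivD derivZ derivX derivC add0r hornerMn !hornerE /=.
    by rewrite -[_ *+ k]mulr_natr; ring.
  have HV := @is_deriveV _ (fun z : R => (a + b * z) ^+ k) x _ 1 (expf_neq0 k (L0 x Ix)) HL.
  have HM := is_deriveM gx HV.
  apply: (is_derive_eq HM).
  have L := L0 x Ix; rewrite /GRing.scale /=.
  (* The truncated exponent [k.-1] is harmless at [k = 0], where its coefficient vanishes. *)
  case: k {HL HV HM} => [|k] /=; first by rewrite !expr0; field.
  rewrite !exprS; field.
  by rewrite L expf_neq0.
move=> x Ix; have [Hf1 Hf2] := Hf x Ix; split; first exact: quot.
have H1 := quot n f1 (f2 x) x Ix Hf2.
have H2 := quot n.+1 f (f1 x) x Ix Hf1.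
have H3 := is_deriveZ (n%:R * b) H2.
have := is_deriveB H1 H3.
set F := (F in is_derive _ _ F _); set d := (d in is_derive _ _ _ d).
have -> : F = (fun z => f1 z / (a + b * z) ^+ n - n%:R * b * f z / (a + b * z) ^+ n.+1).
  by apply: funext => z; rewrite -[in RHS]mulrA.
move=> HF; apply: (is_derive_eq HF).
have L := L0 x Ix; rewrite /d /GRing.scale /= /brk /brk2 !natrM !exprS.
by field; rewrite L expf_neq0.
Qed.

Lemma derive_zero_cst I f : is_interval I -> 
  (forall x, I x -> is_derive x (1 : R) f (0 : R)) -> forall x y, I x -> I y -> f x = f y.
Proof.
move=> iI f0; suff H x y : x <= y -> I x -> I y -> f x = f y.
  move=> x y Ix Iy; have [xy|/ltW yx] := leP x y; first exact: H.
  by apply/esym/H.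
move=> xy Ix Iy.
have sI z : z \in `[x, y] -> I z.
  by rewrite in_itv /= => /andP[xz zy]; apply: (iI _ _ Ix Iy); rewrite xz.
have [||c _ /eqP] := @MVT_segment R f (cst 0) x y xy.
- by move=> z /subset_itv_oo_cc /sI /f0.
- apply: derivable_within_continuous => z zxy.
  by have [] := f0 z (sI z zxy).
- by rewrite mul0r subr_eq0 => /eqP.
Qed.

Lemma derivs2_affine I f f1 f2 : open_interval I -> derivs2 I f f1 f2 ->
  (forall x, I x -> f2 x = 0) ->
  exists nu0 nu1 : R, forall x, I x -> f x = nu0 + nu1 * x.
Proof.
move=> [[x0 Ix0] oI iI] Hf f20.
have f1c x : I x -> f1 x = f1 x0.
  move=> Ix; apply: (@derive_zero_cst I) => // z Iz; rewrite -(f20 z) //.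
  by have [] := Hf z Iz.
exists (f x0 - f1 x0 * x0), (f1 x0) => x Ix.
suff : f x - f1 x0 * x = f x0 - f1 x0 * x0 by move=> <-; rewrite subrK.
apply: (@derive_zero_cst I (fun z => f z - f1 x0 * z)) => // z Iz.
have [Hz _] := Hf z Iz; have H := is_deriveZ (f1 x0) (is_derive_id z (1 : R)).
have := is_deriveB Hz H; rewrite f1c // [_ *: 1]mulr1 subrr.
by congr (is_derive _ _ _ _); apply: funext.
Qed.

(** The bracket is [L^(n+2) (f / L^n)''], so its vanishing makes [f / L^n] affine. *)
Lemma brk_eq0 I f f1 f2 (a b : R) n : open_interval I -> derivs2 I f f1 f2 ->
  (forall x, I x -> a + b * x != 0) ->
  (forall x, I x -> brk n (a + b * x) b (f x) (f1 x) (f2 x) = 0) ->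
  exists nu0 nu1 : R, forall x, I x -> f x = (a + b * x) ^+ n * (nu0 + nu1 * x).
Proof.
move=> oI Hf L0 H0.
have [|nu0 [nu1 H]] := derivs2_affine oI (derivs2_quot n Hf L0).
  by move=> x Ix; rewrite H0 // mul0r.
exists nu0, nu1 => x Ix; rewrite -H // mulrC mulfVK // expf_neq0 //; exact: L0.
Qed.

End Calculus.

(** * Partial derivatives as one-variable derivatives *)

Section Partial.
Variables (R : realType) (m : nat).
Implicit Types (x : 'rV[R]_m) (j : 'I_m) (F : 'rV[R]_m -> R^o).

(** Both sides are limits of the same difference quotient. *)
Lemma partialE j F x : partial j F x = derive1 (fun z => F (upd x j z)) (x 0 j).
Proof.
pose u (h : R) : R^o := h^-1 *: (F (upd x j (h + x 0 j)) - F (upd x j (x 0 j))).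
have uE : (fun h => h^-1 *: ((F \o shift x) (h *: delta_mx 0 j) - F x)) = u.
  apply: funext => h; rewrite /u /= upd_id; congr (_ *: (F _ - _)).
  by apply/rowP => i; rewrite !mxE eqxx /=; case: eqP => [->|]; rewrite ?mulr1 ?mulr0 ?add0r.
by rewrite /partial /derive uE /derive1; congr (lim (fmap _ _)).
Qed.

Lemma partial2E j F x :
  partial j (partial j F) x = derive1n 2 (fun z => F (upd x j z)) (x 0 j).
Proof.
rewrite partialE; set G := (X in derive1n 2 X).
have -> : (fun z => partial j F (upd x j z)) = derive1 G.
  apply: funext => z; rewrite partialE upd_eq.
  by have -> : (fun w => F (upd (upd x j z) j w)) = G by apply: funext => w; rewrite upd_upd.
reflexivity.
Qed.

End Partial.

(** * The bracket as a differential operator on polynomials, for [L = a + b t] *)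

Section PolynomialODE.
Variable R : realType.
Implicit Types (I : set R) (U V W : {poly R}).

Lemma poly_open_eq0 I (p : {poly R}) : I !=set0 -> open I ->
  (forall x, I x -> p.[x] = 0) -> p = 0.
Proof.
move=> [x0 Ix0] oI p0.
have /nbhs_ballP[e /= e0 eI] : nbhs x0 I by exact: open_nbhs_nbhs.
(* Infinitely many distinct points of [I]; the denominator [k + 2] keeps them strictly inside the
   ball of radius [e]. *)
pose f (k : nat) : R := x0 + e / k.+2%:R.
have If k : I (f k).
  apply: eI; rewrite /ball /= /f opprD addrA subrr sub0r normrN.
  rewrite ger0_norm ?divr_ge0 ?ltW // ltr_pdivrMr // ltr_pMr //.
  by rewrite ltr1n.
apply: (@roots_geq_poly_eq0 _ p [seq f k | k <- iota 0 (size p)]).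
- by apply/allP => _ /mapP[k _ ->]; apply/rootP/p0.
- rewrite map_inj_uniq ?iota_uniq // => k l /addrI /(mulfI (lt0r_neq0 e0)) /invr_inj /eqP.
  by rewrite eqr_nat !eqSS => /eqP.
- by rewrite size_map size_iota.
Qed.

Lemma horner_brk n (L Q A0 A1 A2 : {poly R}) t :
  (brk n L Q A0 A1 A2).[t] = brk n L.[t] Q.[t] A0.[t] A1.[t] A2.[t].
Proof. by rewrite /brk /brk2 -!polyC_natr !hornerE. Qed.

Lemma brkB n (L Q a0 a1 a2 b0 b1 b2 : R) :
  brk n L Q (a0 - b0) (a1 - b1) (a2 - b2) = brk n L Q a0 a1 a2 - brk n L Q b0 b1 b2.
Proof. by rewrite /brk /brk2; ring. Qed.

Lemma polybrkB n (L Q : R) U V t :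
  polybrk n L Q (U - V) t = polybrk n L Q U t - polybrk n L Q V t.
Proof. by rewrite /polybrk !derivB !hornerE brkB. Qed.

Lemma size_polyC_mul (c : R) (p : {poly R}) k :
  (size p <= k)%N -> (size (c%:P * p)%R <= k)%N.
Proof. by move=> pk; rewrite mul_polyC (leq_trans (size_scale_leq _ _)). Qed.

Lemma size_mul_le (p q : {poly R}) k l : (size p <= k.+1)%N -> (size q <= l.+1)%N ->
  (size (p * q)%R <= (k + l).+1)%N.
Proof. by move=> pk ql; rewrite (leq_trans (size_polyMleq _ _)) //; lia. Qed.

Lemma size_add_le (p q : {poly R}) k : (size p <= k)%N -> (size q <= k)%N ->
  (size (p + q)%R <= k)%N.
Proof. by move=> pk qk; rewrite (leq_trans (size_polyD _ _)) // geq_max pk. Qed.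

Lemma size_brk n (L Q : {poly R}) (c0 c1 c2 : R) :
  (size L <= 2)%N -> (size Q <= 2)%N -> (size (brk n L Q c0%:P c1%:P c2%:P) <= 3)%N.
Proof.
move=> L2 Q2.
have M (p q : {poly R}) : (size p <= 2)%N -> (size q <= 2)%N -> (size (p * q)%R <= 3)%N.
  exact: (@size_mul_le _ _ 1 1).
rewrite /brk /brk2 -!polyC_natr; apply: size_add_le; last first.
  by rewrite mulrC; do 2!apply: size_polyC_mul; exact: M.
apply: size_add_le; first by rewrite mulrC; apply: size_polyC_mul; exact: M.
rewrite size_polyN mulrC; do 2!apply: size_polyC_mul.
by apply: size_add_le; exact: M.
Qed.

Lemma size_linear (a b : R) : (size (a%:P + b *: 'X)%R <= 2)%N.
Proof.
apply: size_add_le; first by rewrite (leq_trans (size_polyC_leq1 _)).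
by rewrite (leq_trans (size_scale_leq _ _)) // size_polyX.
Qed.

(** On [(y - t)^(m+2)] the bracket is [(m+1) (m+2) (y - t)^m] times the square of [L + b (y - t)],
    and this last expression is the constant [a + b y]. *)
Lemma polybrk_sum_subX m N (c z : 'I_N -> R) (a b t : R) :
  polybrk m.+1 (a + b * t) b (\sum_k c k *: ((z k)%:P - 'X) ^+ m.+2) t =
  \sum_k c k * ((m.+1 * m.+2)%:R * (a + b * z k) ^+ 2 * (z k - t) ^+ m).
Proof.
have [H0 H1 H2] := horner_sum_subX_exp c z m t.
rewrite /polybrk H0 H1 H2 /brk brk2_sumA; apply: eq_bigr => k _.
by rewrite /brk2 !natrM !exprSr; ring.
Qed.

(** The drop of the degree bound from [m + 2] to [m] is visible on the powers [(z - X)^(m+2)], which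
    span. *)
Lemma size_polybrk m (a b : R) U : (size U <= m.+3)%N ->
  exists2 W : {poly R}, (size W <= m.+1)%N & forall t, polybrk m.+1 (a + b * t) b U t = W.[t].
Proof.
have natinj : injective (fun k : 'I_m.+3 => k%:R : R).
  by move=> k l /eqP; rewrite eqr_nat => /eqP /val_inj.
move=> /(span_pow natinj)[c ->].
exists (\sum_(k < m.+3)
  (c k * ((m.+1 * m.+2)%:R * (a + b * k%:R) ^+ 2)) *: (k%:R%:P - 'X) ^+ m).
  rewrite (leq_trans (size_sum _ _ _)) //; apply/bigmax_leqP => k _.
  by rewrite (leq_trans (size_scale_leq _ _)) ?size_subX_exp.
move=> t; rewrite polybrk_sum_subX horner_sum; apply: eq_bigr => k _.
by rewrite !hornerE /=; ring.
Qed.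

(** Expand [W] in powers [(z_k - X)^m] and divide each coefficient by the constant that the bracket
    produces; it is nonzero at nodes off the root of the linear form. *)
Lemma polybrk_surj m (a b : R) W : (a, b) != (0, 0) -> (size W <= m.+1)%N ->
  exists2 V : {poly R}, (size V <= m.+3)%N & forall t, polybrk m.+1 (a + b * t) b V t = W.[t].
Proof.
move=> ab0.
(* The nodes avoid the root of [a + b z]; if [b = 0], then [a / b] is [0]. *)
pose z (k : 'I_m.+1) : R := - (a / b) + k.+1%:R.
have zinj : injective z.
  by move=> k l /addrI /eqP; rewrite eqr_nat eqSS => /eqP /val_inj.
have z0 k : a + b * z k != 0.
  have [b0|b0] := eqVneq b 0.
    by move: ab0; rewrite b0 mul0r addr0 xpair_eqE eqxx andbT.
  rewrite /z mulrDr mulrN [b * (a / b)]mulrC divfK // addrA subrr add0r.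
  by rewrite mulf_neq0 // pnatr_eq0.
move=> /(span_pow zinj)[c ->].
exists (\sum_k
  (c k / ((m.+1 * m.+2)%:R * (a + b * z k) ^+ 2)) *: ((z k)%:P - 'X) ^+ m.+2).
  rewrite (leq_trans (size_sum _ _ _)) //; apply/bigmax_leqP => k _.
  by rewrite (leq_trans (size_scale_leq _ _)) ?size_subX_exp.
move=> t; rewrite polybrk_sum_subX horner_sum; apply: eq_bigr => k _.
have m0 : (m.+1 * m.+2)%:R != 0 :> R by rewrite pnatr_eq0.
have zk := z0 k; rewrite !hornerE /=; move: _%:R m0 => M m0.
by field; rewrite m0 zk.
Qed.

Lemma brk_horner_affine m I f f1 f2 (a b : R) V : open_interval I ->
  derivs2 I f f1 f2 -> (forall x, I x -> a + b * x != 0) ->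
  (forall x, I x -> brk m.+1 (a + b * x) b (f x) (f1 x) (f2 x) =
                    polybrk m.+1 (a + b * x) b V x) ->
  exists nu0 nu1 : R, forall x, I x ->
    f x = V.[x] + (a + b * x) ^+ m.+1 * (nu0 + nu1 * x).
Proof.
move=> oI Hf L0 fV.
have [|nu0 [nu1 H]] := brk_eq0 oI (derivs2B Hf (derivs2_horner (I := I) V)) L0 (n := m.+1).
  by move=> x Ix /=; rewrite brkB fV // subrr.
by exists nu0, nu1 => x Ix; rewrite -H //= addrC subrK.
Qed.

(** A particular solution of degree at most [m + 2] comes from [polybrk_surj]; the homogeneous
    solutions [L^(m+1) (nu0 + nu1 x)] have degree at most [m + 2] too. *)
Lemma brk_solution_poly m I f f1 f2 (a b : R) W : open_interval I ->
  derivs2 I f f1 f2 -> (forall x, I x -> a + b * x != 0) -> (size W <= m.+1)%N ->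
  (forall x, I x -> brk m.+1 (a + b * x) b (f x) (f1 x) (f2 x) = W.[x]) ->
  exists2 U : {poly R}, (size U <= m.+3)%N & forall x, I x -> f x = U.[x].
Proof.
move=> oI Hf L0 sW fW.
have ab0 : (a, b) != (0, 0).
  have [[x0 Ix0] _ _] := oI; apply: contra (L0 x0 Ix0) => /eqP[-> ->].
  by rewrite mul0r addr0.
have [V sV VW] := polybrk_surj ab0 sW.
have [|nu0 [nu1 H]] := brk_horner_affine (V := V) oI Hf L0 (m := m).
  by move=> x Ix; rewrite fW // VW.
exists (V + (a%:P + b *: 'X) ^+ m.+1 * (nu0%:P + nu1 *: 'X)) => [|x Ix]; last first.
  by rewrite H // !hornerE.
apply: size_add_le => //.
rewrite -[m.+3]/(m.+2.+1) -[m.+2]addn1; apply: size_mul_le; last exact: size_linear.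
rewrite (leq_trans (size_poly_exp_leq _ _)) // ltnS -[X in (_ <= X)%N]mul1n leq_mul2r.
by rewrite -ltnS -subn1 ltnS leq_subLR size_linear orbT.
Qed.
End PolynomialODE.

(** * The extremal equation: consequences *)

Lemma card_neq2 m (i l : 'I_m) : l != i ->
  #|[pred s | (s != l) && (s != i)]|.+2 = m.
Proof.
move=> li; rewrite -[RHS](card_ord m) [RHS](cardD1 i) [X in (_ + X)%N](cardD1 l).
by rewrite !inE li !add1n; congr _.+2; apply: eq_card => s; rewrite !inE andbT.
Qed.

Section Extremal.
Variables (R : realType) (m : nat) (be : tensor R m) (I : 'I_m -> set R).
Implicit Types (x y : 'rV[R]_m) (i j : 'I_m) (A : 'I_m -> R -> R).
Hypothesis be_sym : symtensor be.
Hypothesis I_itv : forall j, open_interval (I j).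
Hypothesis Delta_neq0 : forall j x, box I x -> Delta j x != 0.
Hypothesis mubeta_neq0 : forall x, box I x -> mupair be x != 0.

Lemma box_upd x j z : box I x -> I j z -> box I (upd x j z).
Proof. by move=> Ix Iz i; rewrite updE; case: eqP => [->|_]; last exact: Ix. Qed.

Lemma box_point : exists x, box I x.
Proof.
have H j : {z | I j z} by apply: cid; case: (I_itv j).
by exists (\row_j sval (H j)) => j; rewrite mxE; case: (H j).
Qed.

Lemma mupair_slope (al : tensor R m) x j :
  mupair al (upd x j 0) + slope al j x * x 0 j = mupair al x.
Proof. by rewrite -[RHS](congr1 _ (upd_id x j)) [RHS]mupair_affine [slope _ _ _ * _]mulrC. Qed.

Lemma box_affine_neq0 x j : box I x ->
  forall z, I j z -> mupair be (upd x j 0) + slope be j x * z != 0.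
Proof.
by move=> Ix z Iz; rewrite mulrC -mupair_affine; apply/mubeta_neq0/box_upd.
Qed.

(** The derivatives are arguments, so that the equation also makes sense with formal derivatives of
    polynomials. *)
Definition extremal_eqn (f0 f1 f2 : 'I_m -> R -> R) :=
  exists2 al, symtensor al & forall x, box I x ->
    \sum_j brk m.+1 (mupair be x) (slope be j x)
        (f0 j (x 0 j)) (f1 j (x 0 j)) (f2 j (x 0 j)) / Delta j x = mupair al x.

(** In [x_j] the pairing is affine, so [derivs2_quot] gives the bracket over [L^(m+3)], and this
    power cancels. *)
Lemma extremalE A f1 f2 : (forall j, derivs2 (I j) (A j) (f1 j) (f2 j)) ->
  extremal be I A <-> extremal_eqn A f1 f2.
Proof.
move=> HA; suff H x : box I x ->
    \sum_j mupair be x ^+ (m + 3) / Delta j x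
        * partial j (partial j (fun y => A j (y 0 j) / mupair be y ^+ (m + 1))) x =
    \sum_j brk m.+1 (mupair be x) (slope be j x) (A j (x 0 j)) (f1 j (x 0 j)) (f2 j (x 0 j))
      / Delta j x.
  by split=> -[al sal alE]; exists al => // x Ix; rewrite -alE // H.
move=> Ix; apply: eq_bigr => j _; rewrite partial2E.
have -> : (fun z => A j (upd x j z 0 j) / mupair be (upd x j z) ^+ (m + 1)) =
    (fun z => A j z / (mupair be (upd x j 0) + slope be j x * z) ^+ m.+1).
  by apply: funext => z; rewrite upd_eq mupair_affine addn1 [z * _]mulrC.
have L0 := box_affine_neq0 (j := j) Ix.
have [_ oI _] := I_itv j.
have [_ _ ->] := derivs2E oI (derivs2_quot m.+1 (HA j) L0) (Ix j).
rewrite mupair_slope addnS addn2 -mulrA [RHS]mulrC mulrCA; congr (_ * _).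
by rewrite mulrC mulfVK // expf_neq0 // mubeta_neq0.
Qed.

Lemma Delta_upd_neq x i l z : l != i -> Delta l (upd x i z) =
  (x 0 l - z) * \prod_(s | (s != l) && (s != i)) (x 0 l - x 0 s).
Proof.
move=> li; rewrite /Delta (bigD1 i) 1?eq_sym //= upd_eq upd_neq //.
by congr (_ * _); apply: eq_bigr => s /andP[_ si]; rewrite upd_neq.
Qed.

Lemma Delta_upd_eq x i z : Delta i (upd x i z) = \prod_(s | s != i) (z - x 0 s).
Proof. by rewrite /Delta upd_eq; apply: eq_bigr => s si; rewrite upd_neq. Qed.

(* In the variable [x_i] the equation reads [brk_i = W] for a polynomial [W];
   the pole of the [j]-th summand at [x_i = x_j] determines [W] there. *)
Lemma extremal_eqn_polynomial f0 f1 f2 x i : extremal_eqn f0 f1 f2 -> box I x ->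
  exists W : {poly R}, [/\ (size W <= m.+1)%N,
    forall z, I i z ->
      brk m.+1 (mupair be (upd x i 0) + slope be i x * z) (slope be i x)
        (f0 i z) (f1 i z) (f2 i z) = W.[z] &
    forall j, j != i -> let y := upd x i (x 0 j) in
      W.[x 0 j] = brk m.+1 (mupair be y) (slope be j y)
        (f0 j (x 0 j)) (f1 j (x 0 j)) (f2 j (x 0 j))].
Proof.
move=> [al sal alE] Ix.
pose Lp (ga : tensor R m) y := (mupair ga (upd y i 0))%:P + slope ga i y *: 'X.
have LpE ga y z : (Lp ga y).[z] = mupair ga (upd y i z).
  by rewrite mupair_affine /Lp !hornerE mulrC.
pose Sp l := Lp be (upd x l 1) - Lp be (upd x l 0).
have SpE l z : l != i -> (Sp l).[z] = slope be l (upd x i z).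
  by move=> li; rewrite /Sp hornerD hornerN !LpE /slope !(updC _ _ _ li).
pose n l := brk m.+1 (Lp be x) (Sp l) (f0 l (x 0 l))%:P (f1 l (x 0 l))%:P (f2 l (x 0 l))%:P.
have nE l z : l != i -> (n l).[z] = brk m.+1 (mupair be (upd x i z)) (slope be l (upd x i z))
     (f0 l (x 0 l)) (f1 l (x 0 l)) (f2 l (x 0 l)).
  by move=> li; rewrite /n horner_brk SpE // LpE !hornerC.
pose c l := \prod_(s | (s != l) && (s != i)) (x 0 l - x 0 s).
pose P l := \prod_(s | (s != l) && (s != i)) ('X - (x 0 s)%:P).
have c0 l : l != i -> c l != 0.
  move=> li; apply/prodf_neq0 => s /andP[sl _].
  by have /prodf_neq0 := Delta_neq0 l Ix; apply.
pose D := \prod_(s | s != i) ('X - (x 0 s)%:P).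
have DE z : D.[z] = Delta i (upd x i z).
  by rewrite Delta_upd_eq horner_prod; apply: eq_bigr => s _; rewrite !hornerE.
have PE l z : (P l).[z] = \prod_(s | (s != l) && (s != i)) (z - x 0 s).
  by rewrite horner_prod; apply: eq_bigr => s _; rewrite !hornerE.
(* The equation multiplied by [Delta i] and solved for the [i]-th bracket. For [l != i],
   [Delta i / Delta l] equals [- P l / c l] as a function of [x_i]; moving the sum to the other side
   removes the sign. *)
exists (D * Lp al x + \sum_(l | l != i) (c l)^-1 *: (n l * P l)); split.
- have sL ga y : (size (Lp ga y) <= 2)%N by exact: size_linear.
  have cm : (#|(fun r => r != i)|.+1 = m)%N by exact: card_neq.
  apply: size_add_le.
    rewrite -[X in (_ <= X.+1)%N]cm -addn1; apply: size_mul_le; last exact: sL.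
    by rewrite size_prod_XsubC_cond.
  rewrite (leq_trans (size_sum _ _ _)) //; apply/bigmax_leqP => l li.
  rewrite (leq_trans (size_scale_leq _ _)) //.
  have cm2 := card_neq2 li.
  apply: leq_trans (@size_mul_le _ _ _ 2 #|[pred s | (s != l) && (s != i)]| _ _) _.
  + by apply: size_brk => //; apply: size_add_le; rewrite ?size_polyN.
  + by rewrite size_prod_XsubC_cond.
  + by rewrite add2n cm2.
- move=> z Iz; have Iu := box_upd Ix Iz.
  have := alE _ Iu; rewrite (bigD1 i) //= upd_eq slope_upd mupair_affine [z * _]mulrC.
  set B := brk _ _ _ _ _ _; set S := \sum_(_ | _) _ => E.
  have D0 := Delta_neq0 i Iu.
  have -> : B = Delta i (upd x i z) * (mupair al (upd x i z) - S).
    by rewrite -E addrK mulrC divfK.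
  rewrite hornerD hornerM DE LpE mulrBr; congr (_ + _).
  rewrite horner_sum -mulrN /S -sumrN mulr_sumr; apply: eq_bigr => l li.
  rewrite hornerZ hornerM nE // PE upd_neq // (Delta_upd_neq _ _ li) Delta_upd_eq.
  rewrite (bigD1 l) //= -/(c l).
  rewrite (eq_bigl (fun s => (s != l) && (s != i))); last by move=> s; rewrite andbC.
  have xz : x 0 l - z != 0.
    have /prodf_neq0/(_ i) := Delta_neq0 l Iu.
    by rewrite eq_sym li upd_eq upd_neq // => /(_ isT).
  by have cl := c0 l li; rewrite [slope be i x * z]mulrC -mupair_affine; field; rewrite xz cl.
(* At [x_j] the polynomials [D] and [P l] with [l != j] vanish, while [P j] takes the value
   [c j]. *)
- move=> j ji y; rewrite hornerD hornerM DE /y Delta_upd_eq [X in X * _](bigD1 j) //=.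
  rewrite subrr !mul0r add0r.
  rewrite horner_sum (bigD1 j) //= [X in _ + X]big1 ?addr0 => [|l /andP[li lj]]; last first.
    rewrite hornerZ hornerM PE [X in _ * (_ * X)](bigD1 j) /= ?subrr ?mul0r ?mulr0 //.
    by rewrite eq_sym lj.
  by rewrite hornerZ hornerM nE // PE -/(c j) [_^-1 * _]mulrC mulfK // c0.
Qed.

Lemma extremal_polynomial A : (forall j, smooth_on (I j) (A j)) -> extremal be I A ->
  exists U : 'I_m -> {poly R}, [/\ forall j, (size (U j) <= m.+3)%N,
    forall j z, I j z -> A j z = (U j).[z] &
    extremal_eqn (fun j => horner (U j)) (fun j => horner (U j)^`())
      (fun j => horner (U j)^`()^`())].
Proof.
move=> sA eA; have HA j := derivs2_smooth (sA j).
have eqA : extremal_eqn A (fun j => derive1 (A j)) (fun j => derive1n 2 (A j)).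
  by apply/extremalE.
have [x Ix] := box_point.
have H j : {U : {poly R} | (size U <= m.+3)%N /\ forall z, I j z -> A j z = U.[z]}.
  apply: cid; have [W [sW WE _]] := extremal_eqn_polynomial j eqA Ix.
  have [U] := brk_solution_poly (I_itv j) (HA j) (box_affine_neq0 (j := j) Ix) sW WE.
  by exists U.
exists (fun j => sval (H j)); split=> [j|j z Iz|].
- by case: (H j) => U [].
- by case: (H j) => U [_ /=]; apply.
(* Passing through [extremal] replaces the formal derivatives of the polynomials by the derivatives
   of [A], which are equally valid on [I j]. *)
apply/(extremalE (A := fun j => horner (sval (H j)))) => [j|]; first exact: derivs2_horner.
apply/(extremalE (A := fun j => horner (sval (H j)))
  (f1 := fun j => derive1 (A j)) (f2 := fun j => derive1n 2 (A j))) => [j|].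
  have [_ oI _] := I_itv j; apply: derivs2_ext (HA j) => // z; rewrite inE => Iz.
  by case: (H j) => U [_ /=]; apply.
case: eqA => al sal alE; exists al => // y Iy; rewrite -alE //; apply: eq_bigr => j _.
by case: (H j) => U [_ /= <-].
Qed.

(** At [x_j] the polynomial [W] is the bracket of [U j] by cancellation of the pole, and the bracket
    of [U i] because [W] is that bracket as a polynomial in [x_i]. *)
Lemma extremal_eqn_diagonal (U : 'I_m -> {poly R}) x i j :
  extremal_eqn (fun j => horner (U j)) (fun j => horner (U j)^`())
    (fun j => horner (U j)^`()^`()) ->
  box I x -> i != j -> let y := upd x i (x 0 j) in
  polybrk m.+1 (mupair be y) (slope be i y) (U i - U j) (x 0 j) = 0.
Proof.
move=> eU Ix ij y; have [W [_ WE /(_ j)]] := extremal_eqn_polynomial i eU Ix.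
rewrite eq_sym => /(_ ij) /= Wj.
have [I0 oI _] := I_itv i.
(* The point [x_j] lies outside [I i], since [Delta] does not vanish on the box; hence the equation
   on [I i] must first become an identity of polynomials. *)
pose p := brk m.+1 ((mupair be (upd x i 0))%:P + slope be i x *: 'X) (slope be i x)%:P
  (U i) (U i)^`() (U i)^`()^`().
have pW : p = W.
  apply/eqP; rewrite -subr_eq0; apply/eqP/(poly_open_eq0 I0 oI) => z Iz.
  by rewrite hornerD hornerN /p horner_brk !hornerE WE // subrr.
have : p.[x 0 j] = W.[x 0 j] by rewrite pW.
rewrite Wj /p horner_brk !hornerE [_ * x 0 j]mulrC -mupair_affine polybrkB -/y /polybrk.
(* The coordinates [i] and [j] of [y] coincide, so symmetry identifies the two slopes. *)
have -> : slope be j y = slope be i y.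
  have E u : mupair be (upd y j u) = mupair be (upd y i u).
    rewrite /y upd_upd -mupair_swap //; congr mupair.
    by rewrite -[RHS](upd_id _ j) upd_neq // eq_sym.
  by rewrite /slope !E.
by rewrite slope_upd => ->; rewrite subrr.
Qed.
End Extremal.

(** * Decomposable tensors *)

Section Decomposable.
Variables (R : realType) (m : nat) (I : 'I_m -> set R) (A : 'I_m -> R -> R).
Implicit Types (x y : 'rV[R]_m) (i j : 'I_m) (a b t : R).
Hypothesis I_itv : forall j, open_interval (I j).

Lemma brk_scale n (c L Q A0 A1 A2 : R) :
  brk n (c * L) (c * Q) A0 A1 A2 = c ^+ 2 * brk n L Q A0 A1 A2.
Proof. by rewrite /brk /brk2; ring. Qed.

Lemma tpow_neq0 t a b (be : tensor R m) : be = t *: tpow m a b ->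
  (forall x, box I x -> mupair be x != 0) -> forall j z, I j z -> a + b * z != 0.
Proof.
move=> beE L0 j z Iz; have [x Ix] := box_point I_itv.
have := L0 _ (box_upd Ix Iz).
by rewrite beE mupairZ (mupair_tpowD _ _ j) upd_eq !mulf_eq0 !negb_or => /and3P[].
Qed.

(** The antiderivative can only be [A_j / L^(m+1)] with [L = a + b x], whose second derivative is
    the bracket over [L^(m+3)]. *)
Lemma integral_formE a b f1 f2 :
  (forall j, derivs2 (I j) (A j) (f1 j) (f2 j)) -> (forall j z, I j z -> a + b * z != 0) ->
  integral_form I A a b <-> exists2 U : {poly R}, (size U <= m.+1)%N &
    forall j z, I j z -> brk m.+1 (a + b * z) b (A j z) (f1 j z) (f2 j z) = U.[z].
Proof.
move=> HA L0.
have HF j F : (forall z, I j z -> A j z = (a + b * z) ^+ (m + 1) * F z) ->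
    derivs2 (I j) F 
      (fun z => f1 j z / (a + b * z) ^+ m.+1 - m.+1%:R * b * A j z / (a + b * z) ^+ m.+2)
    (fun z => brk m.+1 (a + b * z) b (A j z) (f1 j z) (f2 j z) / (a + b * z) ^+ m.+3).
  move=> AF; have [_ oI _] := I_itv j.
  apply: derivs2_ext (derivs2_quot m.+1 (HA j) (L0 j)) => // z; rewrite inE => Iz.
  by rewrite AF // addn1 mulrC mulKf // expf_neq0 // (L0 j).
split=> -[U sU UA]; exists U => // j.
  move=> z Iz; have [F HU AF] := UA j; have [_ oI _] := I_itv j.
  have [_ _ E1] := derivs2E oI (HF j F AF) Iz; have [_ _] := HU z Iz.
  rewrite E1 addn3; apply: mulIf.
  by rewrite invr_eq0 expf_neq0 // (L0 j).
exists (fun z => A j z / (a + b * z) ^+ m.+1); last first.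
  by move=> z Iz; rewrite addn1 mulrC mulfVK // expf_neq0 // (L0 j).
move=> z Iz; have [_ oI _] := I_itv j.
have [d1 d2 ->] := derivs2E oI (derivs2_quot m.+1 (HA j) (L0 j)) Iz.
by rewrite UA // addn3.
Qed.

Lemma brk_tpow n t a b x i A0 A1 A2 : let c := t * \prod_(r | r != i) (a + b * x 0 r) in
  brk n (mupair (t *: tpow m a b) x) (slope (t *: tpow m a b) i x) A0 A1 A2 =
  c ^+ 2 * brk n (a + b * x 0 i) b A0 A1 A2.
Proof.
move=> c; rewrite /slope !mupairZ -mulrBr -/(slope _ _ _) slope_tpow (mupair_tpowD _ _ i).
by rewrite -brk_scale /c; congr brk; ring.
Qed.

(** All [A_j] have the same bracket [U], which is also the bracket of a single polynomial [V]; in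
    the equation [V] can stand for every [A_j], and [potential_polybrk] applies. *)
Lemma integral_form_extremal t a b : (t != 0) -> (a, b) != (0, 0) ->
  (forall j, smooth_on (I j) (A j)) ->
  (forall j x, box I x -> Delta j x != 0) ->
  (forall x, box I x -> mupair (t *: tpow m a b) x != 0) ->
  integral_form I A a b -> extremal (t *: tpow m a b) I A.
Proof.
move=> t0 ab0 sA D0 L0; have HA j := derivs2_smooth (sA j).
have ab := tpow_neq0 erefl L0.
move/(integral_formE HA ab) => [U sU UA].
have [V sV VU] := polybrk_surj ab0 sU.
have [|al sal alE] := @potential_polybrk _ _ (t *: tpow m a b) _ _ sV.
  exact/symtensorZ/symtensor_tpow.
apply/(extremalE I_itv L0 HA); exists al => // x Ix; rewrite -alE => [|j]; last exact: D0.
by apply: eq_bigr => j _; rewrite /polybrk !brk_tpow UA // -VU.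
Qed.

Lemma extremal_integral_form t a b : (0 < m)%N -> (t != 0) -> 
  (forall j, smooth_on (I j) (A j)) ->
  (forall j x, box I x -> Delta j x != 0) ->
  (forall x, box I x -> mupair (t *: tpow m a b) x != 0) ->
  extremal (t *: tpow m a b) I A -> integral_form I A a b.
Proof.
move=> m0 t0 sA D0 L0 eA.
have ab := tpow_neq0 erefl L0.
have sbe : symtensor (t *: tpow m a b) by exact/symtensorZ/symtensor_tpow.
have [U [sU UA eU]] := extremal_polynomial I_itv D0 L0 sA eA.
have HW j : {W : {poly R} | (size W <= m.+1)%N /\
    forall z, polybrk m.+1 (a + b * z) b (U j) z = W.[z]}.
  by apply: cid; have [W] := size_polybrk a b (sU j); exists W.
pose W j := sval (HW j).
have WE j z : polybrk m.+1 (a + b * z) b (U j) z = (W j).[z].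
  by rewrite /W; case: (HW j) => w [].
(* The diagonal identity is [W i - W j] times the square of a factor built from [t] and the linear
   forms in the other variables; that factor is nonzero. *)
have WW i j : W i = W j.
  have [->//|ij] := eqVneq i j.
  have [I0 oI _] := I_itv j.
  apply/eqP; rewrite -subr_eq0; apply/eqP/(poly_open_eq0 I0 oI) => z Iz.
  have [x Ix] := box_point I_itv.
  have Iu := box_upd Ix Iz.
  have := extremal_eqn_diagonal sbe I_itv D0 eU Iu ij.
  rewrite /= /polybrk brk_tpow !upd_eq => /eqP; rewrite mulf_eq0 => /orP[|/eqP B0]; last first.
    by rewrite hornerD hornerN -!WE -polybrkB.
  rewrite sqrf_eq0 mulf_eq0 (negPf t0) /= => /eqP P0; exfalso; move/eqP: P0; apply/negP.
  by apply/prodf_neq0 => r ri; rewrite upd_neq // (ab r).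
pose i0 := Ordinal m0.
apply/(@integral_formE _ _ (fun j => horner (U j)^`()) (fun j => horner (U j)^`()^`())) => //.
  move=> j; have [_ oI _] := I_itv j.
  by apply: derivs2_ext (derivs2_horner (I := I j) (U j)) => // z; rewrite inE => Iz; rewrite UA.
exists (W i0) => [|j z Iz]; first by rewrite /W; case: (HW i0) => w [].
by rewrite UA // (WW i0 j) -WE.
Qed.

Lemma integral_form_explicit a b : (a, b) != (0, 0) ->
  (forall j, smooth_on (I j) (A j)) -> (forall j z, I j z -> a + b * z != 0) ->
  integral_form I A a b ->
  (b = 0 -> explicit_form_b_eq0 I A) /\ (b != 0 -> explicit_form_b_neq0 I A a b).
Proof.
move=> ab0 sA ab; have HA j := derivs2_smooth (sA j).
move/(integral_formE HA ab) => [U sU UA].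
have [V sV VU] := polybrk_surj ab0 sU.
have Hnu j : {nu : R * R | forall z, I j z ->
    A j z = V.[z] + (a + b * z) ^+ m.+1 * (nu.1 + nu.2 * z)}.
  apply: cid; have [|nu0 [nu1 H]] :=
    brk_horner_affine (V := V) (I_itv j) (HA j) (ab j) (m := m).
    by move=> z Iz; rewrite UA // VU.
  by exists (nu0, nu1).
pose nu j := sval (Hnu j).
have AE j z : I j z -> A j z = V.[z] + (a + b * z) ^+ m.+1 * ((nu j).1 + (nu j).2 * z).
  by rewrite /nu; case: (Hnu j) => w /=; apply.
split=> [b0|b0].
  exists V => //.
  exists (fun j => a ^+ m.+1 * (nu j).1), (fun j => a ^+ m.+1 * (nu j).2) => j z Iz.
  by rewrite AE // b0 mul0r addr0; ring.
pose L : {poly R} := a%:P + b *: 'X.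
have sL : size L = 2.
  by rewrite /L addrC size_polyDl size_scale // size_polyX // ltnS size_polyC_leq1.
have sLm : size (L ^+ m.+1) = m.+2.
  by rewrite -[LHS]prednK ?size_poly_gt0 ?expf_neq0 -?size_poly_gt0 ?sL // size_exp sL mul1n.
have Lm0 : L ^+ m.+1 != 0 by rewrite -size_poly_gt0 sLm.
(* Division by the power of the linear form: the quotient is affine and is absorbed into the
   constants [nu], while the remainder has degree at most [m]. *)
pose Q := V %/ L ^+ m.+1; pose S := V %% L ^+ m.+1.
have sS : (size S <= m.+1)%N by rewrite -ltnS -[X in (_ < X)%N]sLm ltn_modp.
have sQ : (size Q <= 2)%N.
  by rewrite /Q size_divp // sLm leq_subLR addn2.
have QE z : Q.[z] = Q`_0 + Q`_1 * z.
  rewrite (horner_coef_wide _ sQ) !big_ord_recl big_ord0 /=.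
  by rewrite expr0 mulr1 expr1 addr0.
exists S => //; exists (fun j => Q`_0 + (nu j).1), (fun j => Q`_1 + (nu j).2) => j z Iz.
rewrite AE // (divp_eq V (L ^+ m.+1)) -/Q -/S hornerD hornerM QE addn1.
by rewrite horner_exp /L !hornerE /=; ring.
Qed.
End Decomposable.

(** * The case of two variables *)

Section Quartics.
Variable R : realType.

Lemma horner_quartic (E : {poly R}) (p q z : R) : (size E <= 5)%N ->
  let P := E \Po (p%:P + q *: 'X) in let y := p + q * z in
  [/\ P.[z] = E`_0 + E`_1 * y + E`_2 * y ^+ 2 + E`_3 * y ^+ 3 + E`_4 * y ^+ 4,
      P^`().[z] = q * (E`_1 + 2 * E`_2 * y + 3 * E`_3 * y ^+ 2 + 4 * E`_4 * y ^+ 3) &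
      P^`()^`().[z] = q ^+ 2 * (2 * E`_2 + 6 * E`_3 * y + 12 * E`_4 * y ^+ 2)].
Proof.
move=> sE P y; rewrite /P; set Y := p%:P + q *: 'X.
have dY : Y^`() = q%:P by rewrite /Y derivD derivC derivZ derivX add0r alg_polyC.
have dE (p' : {poly R}) : (p' \Po Y)^`() = q *: (p'^`() \Po Y).
  by rewrite deriv_comp dY mulrC mul_polyC.
have sE1 : (size E^`() <= 4)%N by rewrite (leq_trans (size_poly _ _)) //; case: (size E) sE.
have sE2 : (size E^`()^`() <= 3)%N.
  by rewrite (leq_trans (size_poly _ _)) //; case: (size E^`()) sE1.
have yE : Y.[z] = y by rewrite /Y !hornerE.
rewrite !dE derivZ dE !hornerZ !horner_comp yE.
rewrite (horner_coef_wide _ sE) (horner_coef_wide _ sE1) (horner_coef_wide _ sE2).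
by rewrite !big_ord_recl !big_ord0 /= !coef_deriv /= /bump /= ?(add0n,add1n,addn0); split; ring.
Qed.

Lemma comp_affine (C : {poly R}) (p q : R) : q != 0 ->
  exists2 E : {poly R}, (size E <= size C)%N & C = E \Po (p%:P + q *: 'X).
Proof.
move=> q0; pose Z : {poly R} := q^-1 *: ('X - p%:P).
exists (C \Po Z).
  have sZ : (size Z).-1 = 1%N by rewrite /Z size_scale ?invr_eq0 // size_XsubC.
  have := size_comp_poly_leq C Z; rewrite sZ muln1 => /leq_trans.
  have [->|C0] := eqVneq C 0; first by rewrite comp_poly0 size_poly0.
  by apply; rewrite prednK // size_poly_gt0.
rewrite -comp_polyA /Z comp_polyZ comp_polyB comp_polyX comp_polyC addrAC subrr add0r.
by rewrite scalerA mulVf // scale1r comp_polyXr.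
Qed.

(** The seven values at the integers from [-3] to [3] determine all the coefficients; only those
    used below are recorded. *)
Lemma poly6_coef (e0 e1 e2 e3 e4 e5 e6 : R) :
  (forall y, e0 + e1 * y + e2 * y ^+ 2 + e3 * y ^+ 3 + e4 * y ^+ 4 + e5 * y ^+ 5
     + e6 * y ^+ 6 = 0) ->
  [/\ e0 = 0, e1 = 0, e2 = 0 & e4 = 0].
Proof.
move=> H; have := H 0; have := H 1; have := H (-1); have := H 2; have := H (-2).
have := H 3; have := H (-3).
by move=> *; split; lra.
Qed.
End Quartics.

(** * Symmetric biaffine functions of two variables *)

Section TwoVariables.
Variable R : realType.
Implicit Types (x : 'rV[R]_2) (j : 'I_2) (be : tensor R 2) (a b c u v : R).

Lemma ord2_cases j : j = ord0 \/ j = ord_max.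
Proof. by case: j => -[|[|//]] ?; [left|right]; apply/val_inj. Qed.

(** On ['I_2], [rev_ord j] serves as the index of the other variable. *)
Lemma rev_ord2_neq j : rev_ord j != j.
Proof. by case: (ord2_cases j) => ->. Qed.

Lemma big_ord2 j (T : Type) (idx : T) (op : Monoid.com_law idx) (F : 'I_2 -> T) :
  \big[op/idx]_i F i = op (F j) (F (rev_ord j)).
Proof.
rewrite !big_ord_recl big_ord0 Monoid.mulm1.
case: (ord2_cases j) => ->; last rewrite Monoid.mulmC; congr (op (F _) (F _)); exact: val_inj.
Qed.

Lemma Delta2 j x : Delta j x = x 0 j - x 0 (rev_ord j).
Proof.
rewrite /Delta (bigD1 (rev_ord j)) ?rev_ord2_neq //= big1 ?mulr1 // => i /andP[ij ij'].
by case: (ord2_cases i) (ord2_cases j) ij ij' => -> [->|->].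
Qed.

Lemma biaffine_tensor (s0 s1 s2 : R) : exists2 al : tensor R 2, symtensor al &
  forall j x, mupair al x =
    s0 + s1 * (x 0 j + x 0 (rev_ord j)) + s2 * (x 0 j * x 0 (rev_ord j)).
Proof.
(* The products [(1 + u) (1 + v)], [(1 - u) (1 - v)] and [u v] span the symmetric biaffine
   functions. *)
exists (((s0 + s1) / 2) *: tpow 2 1 1 +
  (((s0 - s1) / 2) *: tpow 2 1 (-1) + (s2 - s0) *: tpow 2 0 1)).
  by do 2?apply: symtensorD; apply/symtensorZ/symtensor_tpow.
move=> j x; rewrite !mupairD !mupairZ !mupair_tpow !(big_ord2 j) /=.
by field.
Qed.

Definition biaffine be a b c := forall j x, mupair be x =
  a + b * (x 0 j + x 0 (rev_ord j)) + c * (x 0 j * x 0 (rev_ord j)).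

Lemma biaffine_upd be a b c j x u : biaffine be a b c ->
  mupair be (upd x j u) = a + b * (u + x 0 (rev_ord j)) + c * (u * x 0 (rev_ord j)).
Proof. by move=> bE; rewrite (bE j) upd_eq upd_neq ?rev_ord2_neq. Qed.

Lemma biaffine_slope be a b c j x : biaffine be a b c ->
  slope be j x = b + c * x 0 (rev_ord j).
Proof. by move=> bE; rewrite /slope !(biaffine_upd _ _ _ bE); ring. Qed.

Lemma biaffine_exists be : symtensor be -> exists a b c, biaffine be a b c.
Proof.
move=> sbe; pose L u v := mupair be (upd (upd 0 ord0 u) ord_max v).
have LE x : mupair be x = L (x 0 ord0) (x 0 ord_max).
  by congr mupair; apply/rowP => i; rewrite !updE; case: (ord2_cases i) => ->.
have Lsym u v : L u v = L v u by apply: mupair_swap.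
(* Interpolation at the four points with coordinates [0] and [1]. *)
exists (L 0 0), (L 0 1 - L 0 0), (L 1 1 - L 0 1 - L 1 0 + L 0 0) => j x.
have -> : mupair be x = L (x 0 j) (x 0 (rev_ord j)).
  rewrite LE; case: (ord2_cases j) => -> /=; last rewrite Lsym;
    congr (L (x 0 _) (x 0 _)); exact/val_inj.
have E u v : L u v = L u 0 + v * (L u 1 - L u 0) by exact: mupair_upd.
move: (x 0 j) (x 0 (rev_ord j)) => u v.
by rewrite (E u v) (Lsym u 0) (Lsym u 1) (E 0 u) (E 1 u) (Lsym 1 0); ring.
Qed.

End TwoVariables.

(** * The extremal equation in two variables *)

Section TwoVariablesExtremal.
Variable R : realType.
Variables (be : tensor R 2) (I : 'I_2 -> set R) (A : 'I_2 -> R -> R).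
Implicit Types (x : 'rV[R]_2) (j : 'I_2) (a b c : R).
Hypothesis be_sym : symtensor be.
Hypothesis I_itv : forall j, open_interval (I j).
Hypothesis A_smooth : forall j, smooth_on (I j) (A j).
Hypothesis Delta_neq0 : forall j x, box I x -> Delta j x != 0.
Hypothesis mubeta_neq0 : forall x, box I x -> mupair be x != 0.

Lemma polybrkD n (L Q : R) (U V : {poly R}) t :
  polybrk n L Q (U + V) t = polybrk n L Q U t + polybrk n L Q V t.
Proof. by rewrite /polybrk !derivD !hornerD /brk /brk2; ring. Qed.

Lemma polybrkZ n (L Q c : R) (U : {poly R}) t :
  polybrk n L Q (c *: U) t = c * polybrk n L Q U t.
Proof. by rewrite /polybrk !derivZ !hornerZ /brk /brk2; ring. Qed.

(** Each single summand with [P] is already of the form [<mu, al>], so multiples of [P] may be added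
    to [A_1] and [A_2] independently. *)
Definition biaffine_solution (P : {poly R}) := exists s0 s1 s2 : R, forall j x,
  Delta j x != 0 -> polybrk 3 (mupair be x) (slope be j x) P (x 0 j) / Delta j x =
  s0 + s1 * (x 0 j + x 0 (rev_ord j)) + s2 * (x 0 j * x 0 (rev_ord j)).

Lemma biaffine_solutionP (P : {poly R}) : biaffine_solution P ->
  exists2 al : tensor R 2, symtensor al & forall j x, Delta j x != 0 ->
    polybrk 3 (mupair be x) (slope be j x) P (x 0 j) / Delta j x = mupair al x.
Proof.
move=> [s0 [s1 [s2 H]]]; have [al sal alE] := biaffine_tensor s0 s1 s2.
by exists al => // j x Dx; rewrite H // (alE j).
Qed.

Lemma quartic_form_extremal (P0 P1 : {poly R}) (f0 f1 : R -> R) :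
  (forall z, f0 z = P0.[z]) -> (forall z, f1 z = P1.[z]) ->
  biaffine_solution P0 -> biaffine_solution P1 ->
  quartic_form I A f0 f1 -> extremal be I A.
Proof.
move=> f0E f1E /biaffine_solutionP[al0 sal0 al0E] /biaffine_solutionP[al1 sal1 al1E].
move=> [U sU [nu0 [nu1 AE]]].
have [al sal alE] := potential_polybrk be_sym sU.
pose V j := U + nu0 j *: P0 + nu1 j *: P1.
have HA j : derivs2 (I j) (A j) (horner (V j)^`()) (horner (V j)^`()^`()).
  have [_ oI _] := I_itv j.
  apply: derivs2_ext (derivs2_horner (I := I j) (V j)) => // z; rewrite inE => Iz.
  by rewrite AE // f0E f1E !hornerE.
apply/(extremalE I_itv mubeta_neq0 HA).
exists (al + (\sum_j nu0 j *: al0 + \sum_j nu1 j *: al1)).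
  apply: symtensorD => //; apply: symtensorD; rewrite -scaler_suml; exact: symtensorZ.
move=> x Ix; rewrite mupairD -alE => [|j]; last exact: Delta_neq0.
rewrite mupairD !mupair_sum -!big_split; apply: eq_bigr => j _ /=.
have D0 := Delta_neq0 j Ix.
have -> : A j (x 0 j) = (V j).[x 0 j] by rewrite AE ?f0E ?f1E ?hornerE //.
rewrite -/(polybrk _ _ _ _ _) !polybrkD !polybrkZ -(al0E j) // -(al1E j) //.
by ring.
Qed.

Variables a b c : R.
Hypothesis beE : biaffine be a b c.

(** With [y = b + c x] the pairing is [(y_1 y_2 + D) / c], and the polynomials are [y^3 + D y] and
    [D^2 - y^4]. Their brackets are divisible by [y_1 - y_2]. *)
Lemma biaffine_solution_general : c != 0 -> let D := a * c - b ^+ 2 in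
  biaffine_solution (Poly [:: 0; D; 0; 1] \Po (b%:P + c *: 'X)) /\
  biaffine_solution (Poly [:: D ^+ 2; 0; 0; 0; -1] \Po (b%:P + c *: 'X)).
Proof.
move=> c0 D.
have LE j x : mupair be x = c^-1 * ((b + c * x 0 j) * (b + c * x 0 (rev_ord j)) + D).
  by rewrite (beE j) /D; field.
split.
(* The expansion of the quotient [6 D c (D - y_1 y_2)]. *)
- exists (6 * D * c * (D - b ^+ 2)), (- 6 * D * c * b * c), (- 6 * D * c * c ^+ 2) => j x.
  have sE : (size (Poly [:: 0; D; 0; 1] : {poly R})%R <= 5)%N by apply: leq_trans (size_Poly _) _.
  rewrite Delta2 => Dx; rewrite /polybrk; have [-> -> ->] := horner_quartic b c (x 0 j) sE.
  rewrite (biaffine_slope j x beE) (LE j) !coef_Poly /= /brk /brk2.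
  move: (x 0 j) (x 0 (rev_ord j)) Dx => u v Dx.
  by field; rewrite Dx.
(* The expansion of the quotient [- 12 D^2 c (y_1 + y_2)]. *)
- exists (- 24 * D ^+ 2 * c * b), (- 12 * D ^+ 2 * c * c), 0 => j x.
  have sE : (size (Poly [:: D ^+ 2; 0; 0; 0; -1] : {poly R})%R <= 5)%N.
    exact: (leq_trans (size_Poly _)).
  rewrite Delta2 => Dx; rewrite /polybrk; have [-> -> ->] := horner_quartic b c (x 0 j) sE.
  rewrite (biaffine_slope j x beE) (LE j) !coef_Poly /= /brk /brk2.
  move: (x 0 j) (x 0 (rev_ord j)) Dx => u v Dx.
  by field; rewrite Dx.
Qed.

(** With [y = a + 2 b x] the pairing is [(y_1 + y_2) / 2]; the quotients for [y] and [y^3] are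
    [12 b^3] and [- 12 b^3 y_1 y_2]. *)
Lemma biaffine_solution_c0 : c = 0 ->
  biaffine_solution (Poly [:: 0; 1] \Po (a%:P + (2 * b) *: 'X)) /\
  biaffine_solution (Poly [:: 0; 0; 0; 1] \Po (a%:P + (2 * b) *: 'X)).
Proof.
move=> c0; have LE j x : mupair be x =
    ((a + 2 * b * x 0 j) + (a + 2 * b * x 0 (rev_ord j))) / 2.
  by rewrite (beE j) c0; field.
split.
- exists (12 * b ^+ 3), 0, 0 => j x.
  have sE : (size (Poly [:: 0; 1] : {poly R})%R <= 5)%N by apply: leq_trans (size_Poly _) _.
  rewrite Delta2 => Dx; rewrite /polybrk; have [-> -> ->] := horner_quartic a (2 * b) (x 0 j) sE.
  rewrite (biaffine_slope j x beE) (LE j) !coef_Poly /= /brk /brk2 c0.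
  move: (x 0 j) (x 0 (rev_ord j)) Dx => u v Dx.
  by field; rewrite Dx.
- exists (- 12 * b ^+ 3 * a ^+ 2), (- 24 * a * b ^+ 4), (- 48 * b ^+ 5) => j x.
  have sE : (size (Poly [:: 0; 0; 0; 1] : {poly R})%R <= 5)%N by apply: leq_trans (size_Poly _) _.
  rewrite Delta2 => Dx; rewrite /polybrk; have [-> -> ->] := horner_quartic a (2 * b) (x 0 j) sE.
  rewrite (biaffine_slope j x beE) (LE j) !coef_Poly /= /brk /brk2 c0.
  move: (x 0 j) (x 0 (rev_ord j)) Dx => u v Dx.
  by field; rewrite Dx.
Qed.

Lemma biaffine_decomposes_general : c != 0 -> a * c - b ^+ 2 = 0 -> decomposes be.
Proof.
move=> c0 D0; exists c^-1, b, c; split; first by rewrite invr_eq0.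
  by rewrite xpair_eqE (negPf c0) andbF.
apply/eqP; rewrite -subr_eq0; apply/eqP/mupair_inj => x.
rewrite mupairB mupairZ mupair_tpow (big_ord2 ord0) /= (beE ord0).
have -> : a = b ^+ 2 / c by rewrite -[b ^+ 2](subrK (a * c)) -opprB D0 oppr0 add0r mulfK.
by field.
Qed.

Lemma biaffine_decomposes_c0 : be != 0 -> c = 0 -> b = 0 -> decomposes be.
Proof.
move=> be0 c0 b0; have aE : be = a *: tpow 2 1 0.
  apply/eqP; rewrite -subr_eq0; apply/eqP/mupair_inj => x.
  by rewrite mupairB mupairZ mupair_tpow (big_ord2 ord0) /= (beE ord0) c0 b0; ring.
exists a, 1, 0; split => //; last by rewrite xpair_eqE oner_eq0.
by apply: contra be0 => /eqP a0; rewrite aE a0 scale0r.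
Qed.

(** On the diagonal [x_1 = x_2 = z] the pairing and its slope are polynomials in [z], so the
    diagonal condition on the difference [C] extends from an interval to all [z]. *)
Lemma extremal_biaffine_difference : extremal be I A ->
  exists2 U : {poly R}, (size U <= 5)%N &
  exists2 C : {poly R}, (size C <= 5)%N &
    [/\ forall z, I ord0 z -> A ord0 z = U.[z],
       forall z, I ord_max z -> A ord_max z = U.[z] + C.[z] &
       forall z, polybrk 3 (a + 2 * b * z + c * z ^+ 2) (b + c * z) C z = 0].
Proof.
move=> eA; have [U [sU UA eU]] := extremal_polynomial I_itv Delta_neq0 mubeta_neq0 A_smooth eA.
exists (U ord0) => //; exists (U ord_max - U ord0).
  by apply: size_add_le; rewrite ?size_polyN.
split=> [z|z Iz|]; first exact: UA.
  by rewrite UA // hornerD hornerN addrC subrK.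
pose p (C : {poly R}) :=
  brk 3 (a%:P + (2 * b) *: 'X + c *: 'X ^+ 2) (b%:P + c *: 'X) C C^`() C^`()^`().
have pE C z : (p C).[z] = polybrk 3 (a + 2 * b * z + c * z ^+ 2) (b + c * z) C z.
  by rewrite /p horner_brk !hornerE.
have [x Ix] := box_point I_itv; have [I0 oI _] := I_itv ord0.
suff p0 : p (U ord_max - U ord0) = 0 by move=> z; rewrite -pE p0 horner0.
apply: (poly_open_eq0 I0 oI) => z Iz; rewrite pE.
have Iu := box_upd Ix Iz.
have := extremal_eqn_diagonal be_sym I_itv Delta_neq0 eU Iu 
  (erefl : (ord_max : 'I_2) != ord0).
rewrite /= upd_eq (biaffine_upd _ _ _ beE) (biaffine_slope _ _ beE).
have -> : rev_ord ord_max = ord0 :> 'I_2 by exact/val_inj.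
rewrite !updE /= => <-; congr polybrk; ring.
Qed.

(* In the variable [y = b + c z] the equation reads
   [(y^2 + D)^2 C'' - 6 y (y^2 + D) C' + 12 y^2 C = 0]. *)
Lemma quartic_coef_general (C : {poly R}) : c != 0 -> a * c - b ^+ 2 != 0 -> (size C <= 5)%N ->
  (forall z, polybrk 3 (a + 2 * b * z + c * z ^+ 2) (b + c * z) C z = 0) ->
  exists d0 d1 : R, forall z, C.[z] =
    d0 * ((b + c * z) * (a * c - b ^+ 2 + (b + c * z) ^+ 2)) +
    d1 * ((a * c - b ^+ 2) ^+ 2 - (b + c * z) ^+ 4).
Proof.
move=> c0; set D := a * c - b ^+ 2 => D0 sC H.
have [E sE CE] := comp_affine C b c0.
have {}sE : (size E <= 5)%N by apply: leq_trans sC.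
(* The coefficients of the equation in powers of [y]; those of [y^5] and [y^6] cancel
   identically. *)
have [|e0 e1 e2 _] := @poly6_coef R
   (2 * D ^+ 2 * E`_2) (6 * D ^+ 2 * E`_3 - 6 * D * E`_1)
   (12 * D ^+ 2 * E`_4 - 8 * D * E`_2 + 12 * E`_0)
   (6 * E`_1 - 6 * D * E`_3) (2 * E`_2) 0 0.
  move=> y; have := H ((y - b) / c); rewrite CE /polybrk.
  have [-> -> ->] := horner_quartic b c ((y - b) / c) sE.
  have -> : b + c * ((y - b) / c) = y by field.
  have -> : a + 2 * b * ((y - b) / c) + c * ((y - b) / c) ^+ 2 = (y ^+ 2 + D) / c.
    by rewrite /D; field.
  move: E`_0 E`_1 E`_2 E`_3 E`_4 => d0 d1 d2 d3 d4; rewrite /brk /brk2 => H0; rewrite -[RHS]H0.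
  by field.
exists E`_3, (- E`_4) => z.
have [E2 E1 E0] : [/\ E`_2 = 0, E`_1 = D * E`_3 & E`_0 = - D ^+ 2 * E`_4].
  move: E`_0 E`_1 E`_2 E`_3 E`_4 e0 e1 e2 => d0 d1 d2 d3 d4 e0 e1 e2.
  have D2 : d2 = 0.
    by apply: (mulfI (_ : 2 * D ^+ 2 != 0)); rewrite ?mulr0 // mulf_neq0 ?pnatr_eq0 // expf_neq0.
  split=> //; last by move: e2; rewrite D2 => e2; lra.
  by apply: (mulfI (_ : 6 * D != 0)); [rewrite mulf_neq0 ?pnatr_eq0 | lra].
rewrite CE; have [-> _ _] := horner_quartic b c z sE.
by rewrite E2 E1 E0; ring.
Qed.

(* In the variable [y = a + 2 b z] the equation reads [y^2 C'' - 3 y C' + 3 C = 0]. *)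
Lemma quartic_coef_c0 (C : {poly R}) : c = 0 -> b != 0 -> (size C <= 5)%N ->
  (forall z, polybrk 3 (a + 2 * b * z + c * z ^+ 2) (b + c * z) C z = 0) ->
  exists d0 d1 : R, forall z, C.[z] = d0 * (a + 2 * b * z) + d1 * (a + 2 * b * z) ^+ 3.
Proof.
move=> c0 b0 sC H; have bb : 2 * b != 0 by rewrite mulf_neq0 ?pnatr_eq0.
have [E sE CE] := comp_affine C a bb.
have {}sE : (size E <= 5)%N by apply: leq_trans sC.
(* The coefficients of [4 b^2] times the equation; [y] and [y^3] solve it, which accounts for the
   zeros. *)
have [|e0 _ e2 e4] := @poly6_coef R
  (12 * b ^+ 2 * E`_0) 0 (- 4 * b ^+ 2 * E`_2) 0 (12 * b ^+ 2 * E`_4) 0 0.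
  move=> y; have := H ((y - a) / (2 * b)); rewrite CE /polybrk.
  have [-> -> ->] := horner_quartic a (2 * b) ((y - a) / (2 * b)) sE.
  rewrite c0 !mul0r !addr0.
  have -> : a + 2 * b * ((y - a) / (2 * b)) = y by field.
  by rewrite /brk /brk2 => H0; rewrite -[RHS]H0; ring.
have b2 : b ^+ 2 != 0 by rewrite expf_neq0.
have E0 : E`_0 = 0.
  by apply: (mulfI (_ : 12 * b ^+ 2 != 0)); rewrite ?mulr0 // mulf_neq0 ?pnatr_eq0.
have E2 : E`_2 = 0.
  by apply: (mulfI (_ : - 4 * b ^+ 2 != 0)); rewrite ?mulr0 // mulf_neq0 ?oppr_eq0 ?pnatr_eq0.
have E4 : E`_4 = 0.
  by apply: (mulfI (_ : 12 * b ^+ 2 != 0)); rewrite ?mulr0 // mulf_neq0 ?pnatr_eq0.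
exists E`_1, E`_3 => z; rewrite CE; have [-> _ _] := horner_quartic a (2 * b) z sE.
by rewrite E0 E2 E4; ring.
Qed.

Lemma extremal_quartic_form : be != 0 -> ~ decomposes be -> extremal be I A ->
  (c != 0 -> quartic_form I A
     (fun x : R => (b + c * x) * (a * c - b ^+ 2 + (b + c * x) ^+ 2))
     (fun x : R => (a * c - b ^+ 2) ^+ 2 - (b + c * x) ^+ 4)) /\
  (c = 0 -> quartic_form I A (fun x : R => a + 2 * b * x) (fun x : R => (a + 2 * b * x) ^+ 3)).
Proof.
move=> be0 nd /extremal_biaffine_difference[U sU [C sC [A0 A1 H]]].
have form f0 f1 : (exists d0 d1 : R, forall z, C.[z] = d0 * f0 z + d1 * f1 z) ->
    quartic_form I A f0 f1.
  move=> [d0 [d1 CE]]; exists U => //.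
  (* The polynomial of the first variable is taken as the common part, so only the second one
     carries the difference [C]. *)
  exists (fun j => if j == ord0 then 0 else d0), (fun j => if j == ord0 then 0 else d1) => j z.
  case: (ord2_cases j) => -> Iz /=; first by rewrite A0 // !mul0r !addr0.
  by rewrite A1 // CE addrA.
split=> c0; apply: form.
  apply: quartic_coef_general => //; apply/eqP => D0; exact/nd/biaffine_decomposes_general.
apply: quartic_coef_c0 => //; apply/eqP => b0; exact/nd/biaffine_decomposes_c0.
Qed.

End TwoVariablesExtremal.

Lemma biaffine_solutionZ (R : realType) (k : R) (be : tensor R 2) (P : {poly R}) :
  biaffine_solution be P -> biaffine_solution (k *: be) P.
Proof.
move=> [s0 [s1 [s2 H]]]; exists (k ^+ 2 * s0), (k ^+ 2 * s1), (k ^+ 2 * s2) => j x Dx.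
have -> : polybrk 3 (mupair (k *: be) x) (slope (k *: be) j x) P (x 0 j) =
    k ^+ 2 * polybrk 3 (mupair be x) (slope be j x) P (x 0 j).
  by rewrite /slope !mupairZ -mulrBr; exact: brk_scale.
by rewrite -[LHS]mulrA H //; ring.
Qed.

Lemma case2a_extremal (R : realType) (m : nat) (be : tensor R m) (I : 'I_m -> set R)
    (A : 'I_m -> R -> R) : symtensor be -> (forall j, open_interval (I j)) ->
  (forall j x, box I x -> Delta j x != 0) -> (forall x, box I x -> mupair be x != 0) ->
  case2a be I A -> extremal be I A.
Proof.
move=> sbe I_itv D0 L0 [m2 [a [b [c [k [k0 bE c1 c0]]]]]]; subst m.
pose be' := k^-1 *: be.
have b'E : biaffine be' a b c.
  move=> j x; rewrite mupairZ bE (big_ord2 j) [\prod__ _](big_ord2 j) /=.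
  by rewrite mulrA mulVf // mul1r.
have beE : be = k *: be' by rewrite /be' scalerA divff // scale1r.
have sol P : biaffine_solution be' P -> biaffine_solution be P.
  by rewrite beE; exact: biaffine_solutionZ.
have [c00|c00] := eqVneq c 0.
  have [S0 S1] := biaffine_solution_c0 b'E c00.
  have sE0 : (size (Poly [:: 0; 1] : {poly R})%R <= 5)%N by apply: leq_trans (size_Poly _) _.
  have sE1 : (size (Poly [:: 0; 0; 0; 1] : {poly R})%R <= 5)%N by apply: leq_trans (size_Poly _) _.
  apply: quartic_form_extremal (sol _ S0) (sol _ S1) (c0 c00) => // z.
    by have [-> _ _] := horner_quartic a (2 * b) z sE0; rewrite !coef_Poly /=; ring.
  by have [-> _ _] := horner_quartic a (2 * b) z sE1; rewrite !coef_Poly /=; ring.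
have [S0 S1] := biaffine_solution_general b'E c00.
set D := a * c - b ^+ 2 in S0 S1.
have sE0 : (size (Poly [:: 0; D; 0; 1] : {poly R})%R <= 5)%N by apply: leq_trans (size_Poly _) _.
have sE1 : (size (Poly [:: D ^+ 2; 0; 0; 0; -1] : {poly R})%R <= 5)%N.
  exact: (leq_trans (size_Poly _)).
apply: quartic_form_extremal (sol _ S0) (sol _ S1) (c1 c00) => // z.
  by have [-> _ _] := horner_quartic b c z sE0; rewrite !coef_Poly /= -/D; ring.
by have [-> _ _] := horner_quartic b c z sE1; rewrite !coef_Poly /= -/D; ring.
Qed.

Lemma extremal_case2a (R : realType) (m : nat) (be : tensor R m) (I : 'I_m -> set R)
    (A : 'I_m -> R -> R) :
  m = 2%N -> symtensor be -> be != 0 -> (forall j, open_interval (I j)) ->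
  (forall j, smooth_on (I j) (A j)) ->
  (forall j x, box I x -> Delta j x != 0) -> (forall x, box I x -> mupair be x != 0) ->
  ~ decomposes be -> extremal be I A -> case2a be I A.
Proof.
move=> m2 sbe be0 I_itv sA D0 L0 nd eA; subst m; split=> //.
have [a [b [c bE]]] := biaffine_exists sbe.
have [c1 c0] := extremal_quartic_form sbe I_itv sA D0 L0 bE be0 nd eA.
exists a, b, c, 1; split=> // x.
by rewrite mul1r (big_ord2 ord0) [\prod__ _](big_ord2 ord0) -bE.
Qed.

(** * Three or more variables *)

Section Rigidity.
Variables (R : realType) (m : nat) (be : tensor R m) (I : 'I_m -> set R).
Implicit Types (x y : 'rV[R]_m) (i j k l : 'I_m) (F G : 'rV[R]_m -> R) (u v w z : R).
Hypothesis be_sym : symtensor be.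
Hypothesis I_itv : forall j, open_interval (I j).
Hypothesis mubeta_neq0 : forall x, box I x -> mupair be x != 0.

Definition polynomial_in_each F :=
  forall x l, exists p : {poly R}, forall z, F (upd x l z) = p.[z].

Lemma polynomial_mupair : polynomial_in_each (mupair be).
Proof.
move=> x l; exists ((mupair be (upd x l 0))%:P + slope be l x *: 'X) => z.
by rewrite mupair_affine !hornerE mulrC.
Qed.

Lemma polynomialM F G : polynomial_in_each F -> polynomial_in_each G ->
  polynomial_in_each (fun x => F x * G x).
Proof.
move=> PF PG x l; have [p pE] := PF x l; have [q qE] := PG x l.
by exists (p * q) => z; rewrite pE qE hornerM.
Qed.

Lemma polynomialB F G : polynomial_in_each F -> polynomial_in_each G ->
  polynomial_in_each (fun x => F x - G x).
Proof.
move=> PF PG x l; have [p pE] := PF x l; have [q qE] := PG x l.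
by exists (p - q) => z; rewrite pE qE hornerD hornerN.
Qed.

Lemma polynomial_cst (c : R) : polynomial_in_each (fun=> c).
Proof. by move=> x l; exists c%:P => z; rewrite hornerC. Qed.

Lemma polynomial_upd F i u : polynomial_in_each F ->
  polynomial_in_each (fun x => F (upd x i u)).
Proof.
move=> PF x l; have [->|li] := eqVneq l i.
  by exists (F (upd x i u))%:P => z; rewrite upd_upd hornerC.
by have [p pE] := PF (upd x i u) l; exists p => z; rewrite (updC _ _ _ li).
Qed.

(** The coordinates are freed one at a time: a polynomial in [x_n] that vanishes on the open set
    [I_n] vanishes everywhere. *)
Lemma box_extend F : polynomial_in_each F -> (forall x, box I x -> F x = 0) ->
  forall x, F x = 0.
Proof.
move=> PF F0 x; suff H n : forall y, (forall i, (n <= i)%N -> I i (y 0 i)) -> F y = 0.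
  by apply: (H m) => i; rewrite leqNgt ltn_ord.
elim: n => [|n IH] y Iy; first by apply: F0 => i; apply: Iy.
have [nm|mn] := ltnP n m; last first.
  by apply: IH => i ni; move: (leq_trans mn ni); rewrite leqNgt ltn_ord.
pose j := Ordinal nm; have [p pE] := PF y j; have [I0 oI _] := I_itv j.
rewrite -(upd_id y j) pE (_ : p = 0) ?horner0 //; apply: (poly_open_eq0 I0 oI) => z Iz.
rewrite -pE; apply: IH => i ni; rewrite updE; case: eqP => [->//|/eqP ij].
by apply: Iy; rewrite ltn_neqAle ni andbT; apply: contra ij => /eqP nE; apply/eqP/val_inj.
Qed.

(* The 2 x 2 matrix of coefficients of [<mu, be>] in the variables [x_i], [x_j]
   is singular. *)
Definition rank_one i j x u v :=
  mupair be x * mupair be (upd (upd x i u) j v) =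
  mupair be (upd x i u) * mupair be (upd x j v).

Lemma upd_perm x (s : 'S_m) i u :
  upd (\row_r x 0 (s r)) i u = \row_r (upd x (s i) u) 0 (s r).
Proof. by apply/rowP => r; rewrite !mxE (inj_eq perm_inj). Qed.

Lemma three_variables (C : {poly R}) i j k : C != 0 -> i != j -> k != i -> k != j ->
  (forall x, box I x -> let y := upd x i (x 0 j) in
    polybrk m.+1 (mupair be y) (slope be i y) C (x 0 j) = 0) ->
  forall x, box I x -> forall u v, rank_one i j x u v.
Proof.
move=> C0 ij ki kj H x Ix u v.
pose f a b c := mupair be (upd (upd (upd x i a) j b) k c).
have f_aff a b c : f a b c = f a b 0 + c * (f a b 1 - f a b 0) by exact: mupair_upd.
have fC1 a b c : f a b c = f b a c.
  rewrite /f (updC _ _ _ (_ : j != k)) 1?eq_sym // (updC _ _ _ (_ : i != k)) 1?eq_sym //.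
  rewrite mupair_swap // -(updC _ _ _ (_ : i != k)) 1?eq_sym //.
  by rewrite -(updC _ _ _ (_ : j != k)) // eq_sym.
have fC2 a b c : f a b c = f a c b by apply: mupair_swap => //; rewrite eq_sym.
(* By symmetry [f] is a combination of the elementary symmetric polynomials of three variables; its
   coefficients are finite differences at [0] and [1]. *)
pose c0 := f 0 0 0; pose c1 := f 0 0 1 - f 0 0 0.
pose c2 := f 0 1 1 - f 0 0 1 - f 0 0 1 + f 0 0 0.
pose c3 := f 1 1 1 - 3 * f 0 1 1 + 3 * f 0 0 1 - f 0 0 0.
have fE a b c : f a b c =
    c0 + c1 * (a + b + c) + c2 * (a * b + a * c + b * c) + c3 * (a * b * c).
  have s1 : f 0 1 0 = f 0 0 1 by rewrite fC2.
  have s2 : f 1 0 0 = f 0 0 1 by rewrite fC1 fC2.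
  have s3 : f 1 0 1 = f 0 1 1 by rewrite fC1.
  have s4 : f 1 1 0 = f 0 1 1 by rewrite fC2 fC1.
  rewrite (f_aff a b c) (fC2 a b 0) (fC2 a b 1) (f_aff a 0 b) (f_aff a 1 b).
  rewrite (fC1 a 0 0) (fC1 a 0 1) (fC1 a 1 0) (fC1 a 1 1).
  rewrite !(fC2 0 a _) !(fC2 1 a _) (f_aff 0 0 a) (f_aff 0 1 a) (f_aff 1 0 a) (f_aff 1 1 a).
  by rewrite s1 s2 s3 s4 /c0 /c1 /c2 /c3; ring.
have Hz z w : I j z -> I k w ->
    polybrk m.+1 (f z z w) (f 1 z w - f 0 z w) C z = 0.
  move=> Iz Iw; have Iu := box_upd (box_upd Ix Iz) Iw.
  have := H _ Iu; rewrite /= upd_neq 1?eq_sym // upd_eq.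
  have E a : upd (upd (upd x j z) k w) i a = upd (upd (upd x i a) j z) k w.
    by rewrite (updC _ _ _ ki) (updC x _ _ (_ : j != i)) // eq_sym.
  by rewrite /slope !upd_upd !E.
have e0 z : I j z -> C.[z] != 0 ->
    c0 * c2 - c1 ^+ 2 + (c0 * c3 - c1 * c2) * z + (c1 * c3 - c2 ^+ 2) * z ^+ 2 = 0.
  move=> Iz Cz; have [I0 oI _] := I_itv k.
  (* On [x_i = x_j = z], as functions of the third variable [w], the pairing is [a0 + a1 w] and its
     slope is [g0 + g1 w]. *)
  pose a0 := c0 + 2 * c1 * z + c2 * z ^+ 2; pose a1 := c1 + 2 * c2 * z + c3 * z ^+ 2.
  pose g0 := c1 + c2 * z; pose g1 := c2 + c3 * z.
  pose p := brk m.+1 (a0%:P + a1 *: 'X) (g0%:P + g1 *: 'X)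
    C.[z]%:P C^`().[z]%:P C^`()^`().[z]%:P.
  have p0 : p = 0.
    apply: (poly_open_eq0 I0 oI) => w Iw; rewrite -[RHS](Hz z w Iz Iw) /p horner_brk !hornerE.
    by rewrite !fE /polybrk /a0 /a1 /g0 /g1; congr brk; ring.
  have pw w : brk m.+1 (a0 + a1 * w) (g0 + g1 * w) C.[z] C^`().[z] C^`()^`().[z] = 0.
    by have := congr1 (fun q => q.[w]) p0; rewrite /p horner_brk !hornerE.
  apply/eqP; rewrite -sqrf_eq0; apply/eqP.
  (* A quadratic form vanishing on the line [(a0 + a1 w, g0 + g1 w)] vanishes on
     its span, hence at [(0, a0 g1 - a1 g0)]. *)
  have K0 : (m.+1 * m.+2)%:R * C.[z] != 0 by rewrite mulf_neq0 // pnatr_eq0.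
  apply: (mulfI K0); rewrite mulr0.
  have H0 := pw 0; have H1 := pw 1; have H2 := pw (-1).
  move: C.[z] C^`().[z] C^`()^`().[z] H0 H1 H2 => C0' C1' C2' H0 H1 H2.
  transitivity (brk m.+1 (a0 + a1 * 0) (g0 + g1 * 0) C0' C1' C2' * (a1 ^+ 2 - a0 ^+ 2)
    + brk m.+1 (a0 + a1 * 1) (g0 + g1 * 1) C0' C1' C2' * (a0 ^+ 2 - a0 * a1) / 2
    + brk m.+1 (a0 + a1 * -1) (g0 + g1 * -1) C0' C1' C2' * (a0 ^+ 2 + a0 * a1) / 2); last first.
    by rewrite H0 H1 H2 !mul0r !addr0.
  rewrite (_ : _ + _ * z + _ = a0 * g1 - a1 * g0); last by rewrite /a0 /a1 /g0 /g1; ring.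
  by rewrite /brk /brk2; field.
have [E0 E1 E2] : [/\ c0 * c2 = c1 ^+ 2, c0 * c3 = c1 * c2 & c1 * c3 = c2 ^+ 2].
  have [I0 oI _] := I_itv j.
  pose q : {poly R} := (c0 * c2 - c1 ^+ 2)%:P + (c0 * c3 - c1 * c2) *: 'X +
    (c1 * c3 - c2 ^+ 2) *: 'X ^+ 2.
  have qE z : q.[z] = c0 * c2 - c1 ^+ 2 + (c0 * c3 - c1 * c2) * z + (c1 * c3 - c2 ^+ 2) * z ^+ 2.
    by rewrite /q !hornerE.
  have /eqP : q * C = 0.
    apply: (poly_open_eq0 I0 oI) => z Iz; rewrite hornerM qE.
    have [->|Cz] := eqVneq C.[z] 0; first by rewrite mulr0.
    by rewrite e0 // mul0r.
  rewrite mulf_eq0 (negPf C0) orbF => /eqP q0.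
  have Q z : c0 * c2 - c1 ^+ 2 + (c0 * c3 - c1 * c2) * z + (c1 * c3 - c2 ^+ 2) * z ^+ 2 = 0.
    by rewrite -qE q0 horner0.
  have := Q 0; have := Q 1; have := Q (-1).
  by move=> *; split; lra.
have LE a b : mupair be (upd (upd x i a) j b) = f a b (x 0 k).
  by rewrite /f -[in LHS](upd_id (upd _ _ _) k) !upd_neq // eq_sym.
have xE : mupair be x = f (x 0 i) (x 0 j) (x 0 k) by rewrite -LE !upd_id.
have xiE : mupair be (upd x i u) = f u (x 0 j) (x 0 k).
  by rewrite -LE -[in LHS](upd_id (upd x i u) j) upd_neq // eq_sym.
have xjE : mupair be (upd x j v) = f (x 0 i) v (x 0 k) by rewrite -LE upd_id.
rewrite /rank_one xE xiE xjE LE !fE.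
apply/eqP; rewrite -subr_eq0; apply/eqP.
move: (x 0 i) (x 0 j) (x 0 k) => a b w.
(* The rank-one minor is governed by the same quadratic, now evaluated at [w]. *)
transitivity ((a - u) * (b - v) *
  ((c0 * c2 - c1 ^+ 2) + (c0 * c3 - c1 * c2) * w + (c1 * c3 - c2 ^+ 2) * w ^+ 2)).
  by ring.
by rewrite E0 E1 E2 !subrr !mul0r !addr0 mulr0.
Qed.

(** Rank one makes the ratio of the values of [L] at [x_j = v] and at [x_j = s] independent of the
    other variables; so [L] is a constant times a product of one affine function [l] evaluated at
    each variable. *)
Lemma rank_one_decomposes i j : be != 0 -> i != j ->
  (forall x, box I x -> forall u v, rank_one i j x u v) -> decomposes be.
Proof.
move=> be0 ij Hij.
have R1 x u v : rank_one i j x u v.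
  apply/eqP; rewrite -subr_eq0; apply/eqP.
  apply: (box_extend (F := fun x => mupair be x * mupair be (upd (upd x i u) j v) -
    mupair be (upd x i u) * mupair be (upd x j v))).
    apply: polynomialB; apply: polynomialM; try exact: polynomial_mupair;
      do ?apply: (polynomial_upd (F := mupair be)); try exact: polynomial_mupair.
    apply: (polynomial_upd (F := fun y => mupair be (upd y j v))).
    by apply: polynomial_upd; exact: polynomial_mupair.
  by move=> y Iy; rewrite Hij // subrr.
(* Once freed from the box, the condition passes to every pair [(k, j)] by the symmetry of [be]. *)
have R2 k x u v : k != j -> rank_one k j x u v.
  move=> kj; pose s := tperm i k.
  have si : s i = k by rewrite /s tpermL.
  have sj : s j = j by rewrite /s tpermD // eq_sym.
  have := R1 (\row_r x 0 (s r)) u v; rewrite /rank_one.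
  by rewrite !upd_perm si sj !(mupair_perm _ s be_sym).
have [x0 Ix0] := box_point I_itv.
pose s := x0 0 j; pose L0 := mupair be x0; pose l v := mupair be (upd x0 j v).
have L00 : L0 != 0 := mubeta_neq0 Ix0.
(* The other coordinates are moved to those of [x0] one at a time; each move is an instance of [R2],
   and staying in the box keeps the cancelled factor nonzero. *)
have Hbox v x : box I x -> mupair be (upd x j v) * L0 = l v * mupair be (upd x j s).
  move=> Ix; suff H n : forall y, box I y ->
      (forall r : 'I_m, (n <= r)%N -> y 0 r = x0 0 r) ->
      mupair be (upd y j v) * L0 = l v * mupair be (upd y j s).
    by apply: (H m) => // r; rewrite leqNgt ltn_ord.
  elim: n => [|n IH] y Iy yx0.
    have -> : y = x0 by apply/rowP => r; apply: yx0.
    by rewrite /s upd_id.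
  have [nm|mn] := ltnP n m; last first.
    by apply: IH => // r nr; move: (leq_trans mn nr); rewrite leqNgt ltn_ord.
  pose k := Ordinal nm; set y' := upd y k (x0 0 k).
  have Iy' : box I y' by apply: box_upd.
  have E : mupair be (upd y' j v) * L0 = l v * mupair be (upd y' j s).
    apply: IH => // r nr; rewrite updE; case: eqP => [->//|/eqP rk].
    apply: yx0; rewrite ltn_neqAle nr andbT; apply: contra rk => /eqP nE.
    exact/eqP/val_inj.
  have [kj|kj] := eqVneq k j; first by move: E; rewrite /y' kj !upd_upd.
  have := R2 k (upd y j s) (x0 0 k) v kj; rewrite /rank_one upd_upd.
  rewrite -(updC y _ _ kj) -/y' upd_upd => Er.
  have r0 := mubeta_neq0 (box_upd Iy' (Ix0 j)); rewrite -/s in r0.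
  apply: (mulfI r0); rewrite mulrA -Er -mulrA E; ring.
have Hall v x : mupair be (upd x j v) * L0 = l v * mupair be (upd x j s).
  apply/eqP; rewrite -subr_eq0; apply/eqP.
  apply: (box_extend (F := fun x => mupair be (upd x j v) * L0 - l v * mupair be (upd x j s))).
    by apply: polynomialB; apply: polynomialM; try exact: polynomial_cst;
      apply: polynomial_upd; exact: polynomial_mupair.
  by move=> y Iy; rewrite Hbox // subrr.
have Hany k v x : mupair be (upd x k v) * L0 = l v * mupair be (upd x k s).
  have := Hall v (\row_r x 0 (tperm j k r)); rewrite !upd_perm tpermL.
  by rewrite !(mupair_perm _ (tperm j k) be_sym).
pose a := mupair be (upd x0 j 0); pose b := slope be j x0.
have lE v : l v = a + b * v by rewrite /l mupair_affine mulrC.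
have ls : l s = L0 by rewrite /l /s upd_id.
pose T := mupair be (const_mx s).
(* Setting the coordinates to [s] one after another exchanges each factor [l (x_r)] for [l s]. *)
have LT x : mupair be x * \prod_(i < m) l s = (\prod_i l (x 0 i)) * T.
  suff H n : forall y, (forall r : 'I_m, (n <= r)%N -> y 0 r = s) ->
      mupair be y * \prod_(i < m) l s = (\prod_i l (y 0 i)) * T.
    by apply: (H m) => r; rewrite leqNgt ltn_ord.
  elim: n => [|n IH] y ys.
    have -> : y = const_mx s by apply/rowP => r; rewrite ys // mxE.
    by rewrite mulrC; congr (_ * _); apply: eq_bigr => r _; rewrite mxE.
  have [nm|mn] := ltnP n m; last first.
    by apply: IH => r nr; move: (leq_trans mn nr); rewrite leqNgt ltn_ord.
  pose k := Ordinal nm.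
  have E : mupair be (upd y k s) * \prod_(i < m) l s = (\prod_i l (upd y k s 0 i)) * T.
    apply: IH => // r nr; rewrite updE; case: eqP => [//|/eqP rk].
    apply: ys; rewrite ltn_neqAle nr andbT; apply: contra rk => /eqP nE.
    exact/eqP/val_inj.
  have := Hany k (y 0 k) y; rewrite upd_id => Ek.
  apply: (mulfI L00); rewrite mulrA [L0 * _]mulrC Ek -mulrA E.
  rewrite [in LHS](bigD1 k) //= [in RHS](bigD1 k) //= upd_eq ls.
  rewrite (eq_bigr (fun i => l (y 0 i))) => [|i' ik]; last by rewrite upd_neq.
  by ring.
have ls0 : \prod_(i < m) l s != 0 by apply/prodf_neq0 => r _; rewrite ls.
have beE : be = (T / \prod_(i < m) l s) *: tpow m a b.
  apply/eqP; rewrite -subr_eq0; apply/eqP/mupair_inj => x.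
  rewrite mupairB mupairZ mupair_tpow.
  under [X in _ * X]eq_bigr => r _ do rewrite -lE.
  by apply: (mulIf ls0); rewrite mul0r mulrBl LT; field.
exists (T / \prod_(i < m) l s), a, b; split=> //.
  by apply: contra be0 => /eqP t0; rewrite beE t0 scale0r.
by apply: contra L00; rewrite -ls lE => /eqP[-> ->]; rewrite mul0r addr0.
Qed.
End Rigidity.

Lemma extremal_case2b (R : realType) (m : nat) (be : tensor R m) (I : 'I_m -> set R)
    (A : 'I_m -> R -> R) :
  (3 <= m)%N -> symtensor be -> be != 0 -> (forall j, open_interval (I j)) ->
  (forall j, smooth_on (I j) (A j)) ->
  (forall j x, box I x -> Delta j x != 0) -> (forall x, box I x -> mupair be x != 0) ->
  ~ decomposes be -> extremal be I A -> case2b I A.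
Proof.
move=> m3 sbe be0 I_itv sA D0 L0 nd eA; split=> //.
have [U [sU UA eU]] := extremal_polynomial I_itv D0 L0 sA eA.
pose i0 : 'I_m := Ordinal (ltnW (ltnW m3)).
exists (U i0) => // j z Iz; rewrite UA //.
have [->//|UU] := eqVneq (U j) (U i0).
have ji : j != i0 by apply: contra UU => /eqP ->.
exfalso; apply: nd; apply: (@rank_one_decomposes _ _ be I sbe I_itv L0 j i0) => // x Ix u v.
(* Without a third index the count [card_neq2] would give [m = 2]. *)
have [k /andP[kj ki]] : exists k : 'I_m, (k != j) && (k != i0).
  apply/existsP; rewrite -[X in is_true X]negbK negb_exists; apply/negP => /forallP H.
  have := card_neq2 ji; rewrite (eq_card (B := pred0)) ?card0.
    by move=> m2E; have := m3; rewrite -[X in (_ <= X)%N]m2E.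
  by move=> s; rewrite !inE; apply/negbTE; rewrite negb_and; have := H s; rewrite negb_and.
apply: (@three_variables _ _ be I sbe I_itv (U j - U i0) j i0 k) => //.
  by rewrite subr_eq0.
by move=> y Iy; exact: (extremal_eqn_diagonal sbe I_itv D0 eU Iy ji).
Qed.

Lemma case2b_extremal (R : realType) (m : nat) (be : tensor R m) (I : 'I_m -> set R)
    (A : 'I_m -> R -> R) : symtensor be -> (forall j, open_interval (I j)) ->
  (forall j x, box I x -> Delta j x != 0) -> (forall x, box I x -> mupair be x != 0) ->
  case2b I A -> extremal be I A.
Proof.
move=> sbe I_itv D0 L0 [_ [U sU UA]].
have HA j : derivs2 (I j) (A j) (horner U^`()) (horner U^`()^`()).
  have [_ oI _] := I_itv j.
  by apply: derivs2_ext (derivs2_horner (I := I j) U) => // z; rewrite inE => Iz; rewrite UA.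
have [al sal alE] := potential_polybrk sbe sU.
apply/(extremalE I_itv L0 HA); exists al => // x Ix; rewrite -alE => [|j]; last exact: D0.
by apply: eq_bigr => j _; rewrite UA.
Qed.

(** * Assembly of the decomposable, two-variable and higher cases *)

Theorem theorem4p2p1 (R : realType) (m : nat) (m_ge2 : (2 <= m)%N)
    (beta : tensor R m) (beta_sym : symtensor beta) (beta_neq0 : beta != 0)
    (I : 'I_m -> set R) (I_itv : forall j, open_interval (I j))
    (A : 'I_m -> R -> R)
    (A_smooth : forall j, smooth_on (I j) (A j))
    (A_neq0 : forall j x, I j x -> A j x != 0)
    (Delta_neq0 : forall j x, box I x -> Delta j x != 0)
    (mubeta_neq0 : forall x, box I x -> mupair beta x != 0)
    (g_posdef : metric_posdef beta I A) :
  (extremal beta I A <->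
     case1 beta I A \/
     (~ decomposes beta /\
        (case2a beta I A /\ ~ case2b I A \/ ~ case2a beta I A /\ case2b I A)))
  /\
  (forall t a b : R, t != 0 -> (a, b) != (0, 0) -> beta = t *: tpow m a b ->
     (forall x, mupair beta x = t * \prod_(j < m) (a + b * x 0 j)) /\
     (integral_form I A a b ->
        (b = 0 -> explicit_form_b_eq0 I A) /\
        (b != 0 -> explicit_form_b_neq0 I A a b))).
Proof.
split; last first.
  move=> t a b t0 ab0 betaE; split=> [x|]; first by rewrite betaE mupairZ mupair_tpow.
  have ab := tpow_neq0 I_itv betaE mubeta_neq0.
  exact: integral_form_explicit.
split=> [eA|[[t [a [b [t0 ab0 betaE]]]]|[_ [[c2a _]|[_ c2b]]]]].
- have [[t [a [b [t0 ab0 betaE]]]]|nd] := pselect (decomposes beta).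
    left; exists t, a, b; split=> //; move: mubeta_neq0 eA; rewrite betaE => L0.
    exact: (extremal_integral_form I_itv (ltnW m_ge2) t0 A_smooth Delta_neq0 L0).
  (* The value of [m] alone decides which of (a) and (b) can hold, which yields the exclusivity. *)
  right; split=> //; move: m_ge2; rewrite leq_eqVlt => /predU1P[m2|m3].
    left; split; first exact: (extremal_case2a (esym m2)).
    by case; rewrite -[X in (_ <= X)%N]m2.
  right; split; last exact: extremal_case2b eA.
  by case=> m2; move: m3; rewrite [X in (_ <= X)%N]m2.
- by move: mubeta_neq0; rewrite betaE => L0; exact: integral_form_extremal.
- exact: case2a_extremal.
- exact: case2b_extremal.
Qed.
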